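(* Let $\{a_k\}_{k\in\mathbb N}$ and $\{\sigma_k\}_{k\in\mathbb N}$ be increasing positive sequences such that $$\lim_{k\to\infty}\sigma_{k+1}/\sigma_k=\infty,\qquad \liminf_{k\to\infty}a_{k+1}/a_k=c,\quad c\in(1,\infty].$$ Let $u_\varepsilon(r)$ be the value of the extreme problem $$u_\varepsilon^2(r)=\frac{1}{2\varepsilon^4}\inf_{\eta\in\Theta_2(r)}\sum_{k\in\mathbb N}\eta_k^4 .$$ For $0<r<1/a_1$ choose an integer $m=m(r)\ge2$ with $r\in[1/a_m,1/a_{m-1}]$ and define $$\big(u_\varepsilon^*(r)\big)^2=\frac{1}{2\varepsilon^4(a_m^2-a_{m-1}^2)^2}\left(\frac{(a_m^2r^2-1)^2}{\sigma_{m-1}^4}+\frac{(1-a_{m-1}^2r^2)^2}{\sigma_m^4}\right),$$ $$u_\varepsilon^{\mathrm{lin}}(r)=\frac{1}{\varepsilon^2(a_m^2-a_{m-1}^2)}\left(\frac{a_m^2r^2-1}{\sigma_{m-1}^2}+\frac{1-a_{m-1}^2r^2}{\sigma_m^2}\right).$$ (a) (Sharp asymptotics of $u_\varepsilon$.) $u_\varepsilon(r_\varepsilon)\sim u_\varepsilon^*(r_\varepsilon)$ as $r_\varepsilon\to0$. (b) (Rate asymptotics of $u_\varepsilon$.) As $r_\varepsilon\to0$, $$u_\varepsilon^{\mathrm{lin}}(r_\varepsilon)\big(1/2+o(1)\big)\le u_\varepsilon(r_\varepsilon)\le u_\varepsilon^{\mathrm{lin}}(r_\varepsilon)\big(1/\sqrt2+o(1)\big).$$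 (c) (Distinguishability conditions.) For testing $H_0:\eta=0$ against $H_1:\eta\in\Theta_2(r_\varepsilon)$, as $\varepsilon\to0$, $$\gamma_\varepsilon(r_\varepsilon)\to0\ \text{ if and only if }\ u_\varepsilon^{\mathrm{lin}}(r_\varepsilon)\to\infty;\qquad \gamma_\varepsilon(r_\varepsilon)\to1\ \text{ if and only if }\ u_\varepsilon^{\mathrm{lin}}(r_\varepsilon)\to0.$$
   Context: Model: one observes $y=\{y_k\}_{k\in\mathbb N}$, $y_k=\eta_k+\varepsilon\xi_k$, with $\xi_k$ i.i.d. $N(0,1)$, $\varepsilon>0$ small, $\eta\in\ell^2$ unknown; $E_{\varepsilon,\eta}$ is the corresponding expectation. Sets (case $q=2$): $\Theta_2=\{\eta\in\ell^2:\sum_k|a_k\sigma_k\eta_k|^2\le1\}$, $\Theta_2(r)=\{\eta\in\Theta_2:\sum_k\sigma_k^2\eta_k^2\ge r^2\}$. $r_\varepsilon>0$ is a family with $r_\varepsilon\to0$ as $\varepsilon\to0$. A (randomized) test $\psi$ is a measurable function of $y$ with values in $[0,1]$, and the minimax total error probability is $$\gamma_\varepsilon(r)=\inf_\psi\Big(E_{\varepsilon,0}\psi+\sup_{\eta\in\Theta_2(r)}E_{\varepsilon,\eta}(1-\psi)\Big).$$ $A\sim B$ means the ratio tends to $1$. *)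

(* Defs.v *)
From HB Require Import structures.
From mathcomp Require Export all_boot all_order all_algebra.
From mathcomp Require Export all_classical all_reals all_analysis.

Set Implicit Arguments.
Unset Strict Implicit.
Unset Printing Implicit Defensive.

Import Order.TTheory GRing.Theory Num.Theory.
Import numFieldNormedType.Exports.

Local Open Scope classical_set_scope.
Local Open Scope ring_scope.

(* Sequences indexed by {1, 2, ...} are represented by functions on [nat],
   index k standing for the (k+1)-st term. Sums of nonnegative series are taken
   in [\bar R], so that divergent series have the value +oo. *)

Definition ell2 {R : realType} : set (nat -> R) :=
  [set eta | (\sum_(0 <= k <oo) (eta k ^+ 2)%:E < +oo)%E].

Definition Theta2 {R : realType} (a sigma : nat -> R) : set (nat -> R) :=
  [set eta | ell2 eta /\
    (\sum_(0 <= k <oo) (`|a k * sigma k * eta k| ^+ 2)%:E <= 1%:E)%E].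

Definition Theta2r {R : realType} (a sigma : nat -> R) (r : R) :
    set (nat -> R) :=
  [set eta | Theta2 a sigma eta /\
    ((r ^+ 2)%:E <= \sum_(0 <= k <oo) (sigma k ^+ 2 * eta k ^+ 2)%:E)%E].

(* The infimum is finite as soon as [Theta2r a sigma r] is nonempty, i.e. for
   all small [r]; otherwise it is +oo and [fine] returns 0. *)
Definition u_eps {R : realType} (a sigma : nat -> R) (eps r : R) : R :=
  Num.sqrt ((2 * eps ^+ 4)^-1 *
    fine (ereal_inf [set (\sum_(0 <= k <oo) (eta k ^+ 4)%:E)%E
                    | eta in Theta2r a sigma r])).

(* [m r] is a choice of m(r). In 0-based indexing the conditions m >= 2 and
   r in [1/a_m, 1/a_(m-1)] keep their shape, with m >= 1. *)
Definition m_choice {R : realType} (a : nat -> R) (m : R -> nat) : Prop :=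
  forall r : R, 0 < r < (a 0%N)^-1 ->
    (1 <= m r)%N /\ (a (m r))^-1 <= r <= (a (m r).-1)^-1.

Definition u_star {R : realType} (a sigma : nat -> R) (m : R -> nat)
    (eps r : R) : R :=
  Num.sqrt
    ((2 * eps ^+ 4 * (a (m r) ^+ 2 - a (m r).-1 ^+ 2) ^+ 2)^-1 *
     ((a (m r) ^+ 2 * r ^+ 2 - 1) ^+ 2 / sigma (m r).-1 ^+ 4 +
      (1 - a (m r).-1 ^+ 2 * r ^+ 2) ^+ 2 / sigma (m r) ^+ 4)).

Definition u_lin {R : realType} (a sigma : nat -> R) (m : R -> nat)
    (eps r : R) : R :=
  (eps ^+ 2 * (a (m r) ^+ 2 - a (m r).-1 ^+ 2))^-1 *
  ((a (m r) ^+ 2 * r ^+ 2 - 1) / sigma (m r).-1 ^+ 2 +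
   (1 - a (m r).-1 ^+ 2 * r ^+ 2) / sigma (m r) ^+ 2).

(* [obs_space R] is the space of real sequences with its product sigma-algebra. *)
Definition cylinders (R : realType) : set (set (nat -> R)) :=
  [set C | exists k (B : set R),
    measurable B /\ C = [set y : nat -> R | B (y k)]].

Definition obs_space (R : realType) := g_sigma_algebraType (@cylinders R).

Definition is_test {R : realType} (psi : obs_space R -> R) : Prop :=
  measurable_fun [set: obs_space R] psi /\ forall y, 0 <= psi y <= 1.

Definition mutually_independent {R : realType} {d : measure_display}
    {T : measurableType d} {P : probability T R}
    (xi : nat -> {RV P >-> R}) : Prop :=
  forall (J : seq nat) (B : nat -> set R), uniq J ->
    (forall k, measurable (B k)) ->
    P (\bigcap_(k in [set` J]) (xi k @^-1` B k)) =
    (\prod_(k <- J) P (xi k @^-1` B k))%E.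

Definition iid_standard_normal {R : realType} {d : measure_display}
    {T : measurableType d} {P : probability T R}
    (xi : nat -> {RV P >-> R}) : Prop :=
  (forall k (A : set R), measurable A ->
     distribution P (xi k) A = normal_prob 0 1 A) /\
  mutually_independent xi.

Definition observation {R : realType} {d : measure_display}
    {T : measurableType d} {P : probability T R}
    (xi : nat -> {RV P >-> R}) (eps : R) (eta : nat -> R) (w : T) :
    obs_space R :=
  fun k => eta k + eps * xi k w.

Definition Eobs {R : realType} {d : measure_display}
    {T : measurableType d} {P : probability T R}
    (xi : nat -> {RV P >-> R}) (eps : R) (eta : nat -> R)
    (f : obs_space R -> R) : \bar R :=
  ('E_P[fun w => f (observation xi eps eta w)])%E.

Definition gamma_eps {R : realType} {d : measure_display}
    {T : measurableType d} {P : probability T R}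
    (xi : nat -> {RV P >-> R}) (a sigma : nat -> R) (eps r : R) : \bar R :=
  ereal_inf
    [set (Eobs xi eps (fun=> 0%R) psi +
          ereal_sup [set Eobs xi eps eta (fun y => 1 - psi y)%R
                    | eta in Theta2r a sigma r])%E
    | psi in [set psi | is_test psi]].

(* Main.v *)
(** Put x_k = sigma_k^2 eta_k^2, p = m - 1 and let x* be the point supported on
    {p, m} at which both constraints sum x_k >= r^2 and sum a_k^2 x_k <= 1 are
    active. Then u_eps^*^2 is the value of the objective at x* and
    u_eps^lin = |eta*|^2 / eps^2, so x* gives the upper bound in (a), and (b)
    compares the l^1 and l^2 norms of a vector with two entries.

    The lower bound in (a) is Lagrangian duality. For weights
    l_k = la - mu a_k^2, nonpositive for k > m, every feasible x satisfies
    sum_(k <= m) l_k x_k >= la r^2 - mu = l_p x*_p + l_m x*_m. The gap condition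
    on a permits l_m = x*_m / sigma_m^4 and l_p = x*_p / sigma_p^4 + (1 + C) l_m,
    and the loss is of smaller order since sigma_(k+1) / sigma_k tends to
    infinity. With l_m = sigma_m^-2 and l_p = sigma_p^-2 the same duality yields
    weights g_k = l_k sigma_k^2 of bounded sum with
    sum_(k <= m) g_k eta_k^2 >= eps^2 u_eps^lin on the whole alternative.

    For (c), the test 1 - exp (- t/2 sum g_k (y_k/eps)^2) has error probabilities
    that are explicit Gaussian integrals, bounded in terms of t and u_eps^lin.
    Conversely gamma_eps is at least the total error of testing 0 against eta*,
    and the likelihood ratio L of that problem has E L = 1 and
    E L^2 = exp u_eps^lin. *)

From HB Require Import structures.
Require Import Defs.
From mathcomp Require Import ring lra measurable_realfun.
Set Implicit Arguments.
Unset Strict Implicit.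
Unset Printing Implicit Defensive.

Import Order.TTheory GRing.Theory Num.Theory.
Import numFieldNormedType.Exports.
Local Open Scope classical_set_scope.
Local Open Scope ring_scope.

(** * The extreme problem *)

Lemma ge0_series_le_partial {R : realType} (f : nat -> R) n :
  (forall k, 0 <= f k) ->
  ((\sum_(0 <= k < n) f k)%:E <= \sum_(0 <= k <oo) (f k)%:E)%E.
Proof.
move=> f0; rewrite -sumEFin; apply: nneseries_lim_ge => k _ _.
by rewrite lee_fin.
Qed.

Lemma Theta2r_dual {R : realType} (a sigma eta : nat -> R) (r la mu : R) n :
  Theta2r a sigma r eta -> 0 <= la -> 0 <= mu ->
  (forall k, (n <= k)%N -> la <= mu * a k ^+ 2) ->
  la * r ^+ 2 - mu <=
    \sum_(0 <= k < n) (la - mu * a k ^+ 2) * sigma k ^+ 2 * eta k ^+ 2.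
Proof.
move=> [[_ Ha] Hr] la0 mu0 lamu.
pose x k := sigma k ^+ 2 * eta k ^+ 2.
have x0 k : 0 <= x k by rewrite mulr_ge0 ?sqr_ge0.
have xE k : `|a k * sigma k * eta k| ^+ 2 = a k ^+ 2 * x k.
  by rewrite real_normK ?num_real// /x !exprMn mulrA.
have ax0 k : 0 <= a k ^+ 2 * x k by rewrite mulr_ge0 ?sqr_ge0.
have max0 k : 0 <= mu * (a k ^+ 2 * x k) by rewrite mulr_ge0.
have lax0 k : 0 <= la * x k by rewrite mulr_ge0.
have {}Ha : (\sum_(0 <= k <oo) (mu * (a k ^+ 2 * x k))%:E <= mu%:E)%E.
  under eq_eseriesr do rewrite EFinM.
  rewrite nneseriesZl; last by move=> k _; rewrite lee_fin.
  rewrite -[leRHS]mule1 lee_wpmul2l//.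
  by under eq_eseriesr do rewrite -xE.
have {}Hr : ((la * r ^+ 2)%:E <= \sum_(0 <= k <oo) (la * x k)%:E)%E.
  under eq_eseriesr do rewrite EFinM.
  rewrite nneseriesZl; last by move=> k _; rewrite lee_fin.
  by rewrite EFinM lee_wpmul2l// lee_fin.
rewrite (nneseries_split 0 n) in Ha; last by move=> k _; rewrite lee_fin.
rewrite (nneseries_split 0 n) in Hr; last by move=> k _; rewrite lee_fin.
rewrite add0n !sumEFin in Ha Hr.
have tail : (\sum_(n <= k <oo) (la * x k)%:E <=
    \sum_(n <= k <oo) (mu * (a k ^+ 2 * x k))%:E)%E.
  rewrite -(nneseries_addn (f := fun k => (la * x k)%:E)); last first.
    by move=> k; rewrite lee_fin.
  rewrite -(nneseries_addn (f := fun k => (mu * (a k ^+ 2 * x k))%:E)); last first.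
    by move=> k; rewrite lee_fin.
  apply: lee_nneseries => k _; rewrite lee_fin//.
  by rewrite mulrA ler_wpM2r// lamu// leq_addl.
(* Finiteness of this tail, which follows from the bound [mu] on the whole series, allows the two
   inequalities to be subtracted in [R]. *)
have tfin : (\sum_(n <= k <oo) (mu * (a k ^+ 2 * x k))%:E)%E \is a fin_num.
  rewrite ge0_fin_numE; last by apply: nneseries_ge0 => k _ _; rewrite lee_fin.
  rewrite (@le_lt_trans _ _ mu%:E)// ?ltry//; apply: le_trans Ha.
  by rewrite leeDr// lee_fin sumr_ge0.
move: (le_trans Hr (leeD2l _ tail)) Ha.
rewrite -(fineK tfin); set t := fine _.
rewrite -!EFinD !lee_fin => H1 H2.
rewrite (_ : \sum_(0 <= k < n) _ = \sum_(0 <= k < n) la * x k -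
   \sum_(0 <= k < n) mu * (a k ^+ 2 * x k)).
  lra.
by rewrite -sumrB; apply: eq_bigr => k _; rewrite /x; ring.
Qed.

(** * Sequences supported on two consecutive indices *)

Lemma two_point_series {R : realType} (f : nat -> R) p :
  (forall k, 0 <= f k) -> (forall k, k != p -> k != p.+1 -> f k = 0) ->
  (\sum_(0 <= k <oo) (f k)%:E = (f p + f p.+1)%:E)%E.
Proof.
move=> f0 fz.
rewrite (nneseries_split 0 p.+2); last by move=> k _; rewrite lee_fin.
rewrite add0n eseries0 ?adde0; last first.
  move=> k kp _; rewrite fz//; apply/eqP => kE; move: kp; rewrite kE ?ltnn//.
  by rewrite ltnNge leqnSn.
rewrite sumEFin !big_nat_recr//= big_nat big1 ?add0r// => k /andP[_ kp].
by rewrite fz// ltn_eqF// ltnW.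
Qed.

Definition two_point {R : realType} (p : nat) (y z : R) : nat -> R :=
  fun k => if k == p then y else if k == p.+1 then z else 0.

Lemma two_pointl {R : realType} p (y z : R) : two_point p y z p = y.
Proof. by rewrite /two_point eqxx. Qed.

Lemma two_pointr {R : realType} p (y z : R) : two_point p y z p.+1 = z.
Proof. by rewrite /two_point eqxx eqn_leq ltnn. Qed.

Lemma two_point0 {R : realType} p (y z : R) k :
  k != p -> k != p.+1 -> two_point p y z k = 0.
Proof. by rewrite /two_point => /negbTE -> /negbTE ->. Qed.

Lemma two_point_Theta2r {R : realType} (a sigma : nat -> R) (r y z : R) p :
  sigma p ^+ 2 * y ^+ 2 + sigma p.+1 ^+ 2 * z ^+ 2 = r ^+ 2 ->
  a p ^+ 2 * (sigma p ^+ 2 * y ^+ 2) +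
    a p.+1 ^+ 2 * (sigma p.+1 ^+ 2 * z ^+ 2) = 1 ->
  Theta2r a sigma r (two_point p y z).
Proof.
move=> Hr Ha; split; first split.
- rewrite /ell2 /= (@two_point_series _ (fun k => two_point p y z k ^+ 2) p).
  + by rewrite ltry.
  + by move=> k; exact: sqr_ge0.
  + by move=> k kp kp1; rewrite two_point0// expr0n.
- rewrite (@two_point_series _
    (fun k => `|a k * sigma k * two_point p y z k| ^+ 2) p).
  + rewrite two_pointl two_pointr !real_normK ?num_real// !exprMn lee_fin.
    by rewrite -Ha !mulrA.
  + by move=> k; exact: sqr_ge0.
  + by move=> k kp kp1; rewrite two_point0// mulr0 normr0 expr0n.
- rewrite (@two_point_series _
    (fun k => sigma k ^+ 2 * two_point p y z k ^+ 2) p).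
  + by rewrite two_pointl two_pointr lee_fin Hr.
  + by move=> k; rewrite mulr_ge0 ?sqr_ge0.
  + by move=> k kp kp1; rewrite two_point0// expr0n mulr0.
Qed.

(** The quotients satisfy s_(n+1) = rho_n (1 + s_n) with rho_n = tau_n / tau_(n+1). They stay
    bounded once rho_n <= 1/2, and then rho_n -> 0 gives the limit. *)
Lemma ratio_sum_cvg0 {R : realType} (tau : nat -> R) :
  (forall k, 0 < tau k) -> tau k / tau k.+1 @[k --> \oo] --> (0 : R) ->
  (\sum_(0 <= k < n) tau k) / tau n @[n --> \oo] --> (0 : R).
Proof.
move=> tau0 ratio0; pose s n := (\sum_(0 <= k < n) tau k) / tau n.
have s_ge0 n : 0 <= s n.
  by rewrite divr_ge0 ?sumr_ge0// => *; exact: ltW.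
have sS n : s n.+1 = (tau n / tau n.+1) * (1 + s n).
  rewrite /s big_nat_recr//=; field.
  by rewrite !gt_eqF.
have [N _ HN] : \forall n \near \oo, tau n / tau n.+1 <= 2^-1.
  by near=> n; apply/ltW; near: n; apply: (cvgr_lt 0) => //; rewrite invr_gt0.
(* As [M >= 1], (1 + M) / 2 <= M, so the bound [M] propagates along the recursion. *)
pose M := Num.max 1 (s N).
have sM n : (N <= n)%N -> s n <= M.
  elim: n => [|n IH]; first by rewrite leqn0 => /eqP <-; rewrite le_max lexx orbT.
  rewrite leq_eqVlt => /predU1P[<-|]; first by rewrite le_max lexx orbT.
  rewrite ltnS => Nn; rewrite sS.
  apply: (@le_trans _ _ (2^-1 * (1 + M))).
    apply: ler_pM; rewrite ?divr_ge0 ?addr_ge0// ?(ltW (tau0 _))//.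
      exact: HN.
    by rewrite lerD2l IH.
  have : 1 <= M by rewrite le_max lexx.
  lra.
rewrite -(cvg_shiftn 1) /=.
apply: (@squeeze_cvgr _ _ _ _ (fun=> 0) (fun n => tau n / tau n.+1 * (1 + M))).
- near=> n; rewrite addn1 -/(s n.+1) s_ge0 /= sS ler_wpM2l//.
    by rewrite divr_ge0// ltW.
  by rewrite lerD2l sM//; near: n; exact: nbhs_infty_ge.
- exact: cvg_cst.
- by rewrite -[X in _ --> X](mul0r (1 + M)); apply: cvgMr_tmp; exact: ratio0.
Unshelve. all: by end_near. Qed.

(** Weights la - mu a_k^2 are determined by their values [lp], [lm] at [p], [p.+1]; since (xp, xm)
    makes both constraints active, the dual value la r^2 - mu is lp xp + lm xm. The margin [C * lm]
    between [lp] and [lm] is what lets the gap condition make the weight at [p.+2] nonpositive. *)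
Lemma dual_weights {R : realType} (a sigma : nat -> R) (r xp xm C lp lm : R) p :
  (forall k, 0 < a k) -> nondecreasing_seq a -> 0 <= C ->
  (forall k, (p <= k)%N -> a k ^+ 2 <= C * (a k.+1 ^+ 2 - a k ^+ 2)) ->
  xp + xm = r ^+ 2 -> a p ^+ 2 * xp + a p.+1 ^+ 2 * xm = 1 ->
  0 <= lm -> lm + C * lm <= lp ->
  exists l : nat -> R,
    [/\ l p = lp, l p.+1 = lm,
        forall k, (k < p.+2)%N -> 0 <= l k,
        forall k, (k < p)%N -> l k <= (1 + C) * lp &
        forall eta, Theta2r a sigma r eta ->
          lp * xp + lm * xm <=
            \sum_(0 <= k < p.+2) l k * sigma k ^+ 2 * eta k ^+ 2].
Proof.
move=> a_gt0 a_incr C0 aC Hr Ha lm0 lplm.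
have a2_incr k j : (k <= j)%N -> a k ^+ 2 <= a j ^+ 2.
  by move=> kj; rewrite lerXn2r ?nnegrE ?(ltW (a_gt0 _))// a_incr.
have A0 : 0 < a p ^+ 2 by rewrite exprn_gt0.
have CD0 := lt_le_trans A0 (aC p (leqnn p)).
have {}C0 : 0 < C.
  by rewrite lt0r C0 andbT; apply: contraTneq CD0 => ->; rewrite mul0r ltxx.
have D0 : 0 < a p.+1 ^+ 2 - a p ^+ 2 by rewrite -(pmulr_rgt0 _ C0).
have Clm : 0 <= C * lm by rewrite mulr_ge0// ltW.
set A := a p ^+ 2 in A0 D0 Ha *; set B := a p.+1 ^+ 2 in D0 Ha *.
(* [la - mu * a k ^+ 2] interpolates [lp] at [p] and [lm] at [p.+1]; the gap
   condition makes it nonpositive beyond [p.+1]. *)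
pose mu := (lp - lm) / (B - A); pose la := lp + mu * A.
have muD : mu * (B - A) = lp - lm by rewrite divfK// gt_eqF.
have mu0 : 0 <= mu by rewrite divr_ge0 ?(ltW D0)//; lra.
have lp0 : 0 <= lp by lra.
have la0 : 0 <= la by rewrite addr_ge0// mulr_ge0// ltW.
have laB : la = lm + mu * B by rewrite /la; lra.
exists (fun k => la - mu * a k ^+ 2); split.
- by rewrite /la -/A; ring.
- by rewrite laB -/B; ring.
- move=> k; rewrite ltnS => kp; rewrite laB.
  have := ler_wpM2l mu0 (a2_incr _ _ kp); rewrite -/B; lra.
- move=> k kp; have : 0 <= mu * a k ^+ 2 by rewrite mulr_ge0 ?sqr_ge0.
  (* Here la = lp + mu A, and mu A <= C mu (B - A) = C (lp - lm). *)
  have := ler_wpM2l mu0 (aC p (leqnn p)); rewrite -/A -/B (mulrCA mu C) muD /la.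
  lra.
- move=> eta eta_in.
  rewrite (_ : lp * xp + lm * xm = la * r ^+ 2 - mu).
    apply: Theta2r_dual => // k pk.
    have h1 := a2_incr _ _ pk.
    have := aC p.+1 (leqnSn p); rewrite -/B.
    set E := a p.+2 ^+ 2 in h1 *; move=> h2.
    (* After multiplication by C: C lm <= lp - lm = mu (B - A) <= mu B <= C mu (E - B), the last
       inequality being the gap condition at [p.+1]. *)
    suff : lm <= mu * (E - B) by rewrite laB; have := ler_wpM2l mu0 h1; lra.
    rewrite -(ler_pM2l C0) (mulrCA C mu).
    have := ler_wpM2l mu0 h2.
    have : mu * (B - A) <= mu * B by rewrite ler_wpM2l// gerBl ltW.
    lra.
  have -> : lm = la - mu * B by rewrite laB addrK.
  have -> : lp = la - mu * A by rewrite /la addrK.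
  by rewrite -Hr -[mu in RHS]mulr1 -Ha; ring.
Qed.

(** Each eta_k^4 is minorized by a tangent in the variable eta_k^2, and the linear part is bounded
    by [dual_weights]. The factor subtracted from 1 collects two losses: the shift of [lp] away from
    wp xp, and the weights below [p]. *)
Lemma quartic_lower_bound {R : realType} (a sigma : nat -> R)
    (r xp xm C : R) p (eta : nat -> R) :
  (forall k, 0 < a k) -> nondecreasing_seq a -> (forall k, 0 < sigma k) ->
  0 <= C ->
  (forall k, (p <= k)%N -> a k ^+ 2 <= C * (a k.+1 ^+ 2 - a k ^+ 2)) ->
  xp + xm = r ^+ 2 -> a p ^+ 2 * xp + a p.+1 ^+ 2 * xm = 1 ->
  0 <= xp -> 0 <= xm -> sigma p <= sigma p.+1 ->
  Theta2r a sigma r eta ->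
  (((1 - ((1 + C) ^+ 2 * (sigma p / sigma p.+1) ^+ 4 +
      2 * (1 + C) ^+ 4 * ((\sum_(0 <= k < p) sigma k ^+ 4) / sigma p ^+ 4))) *
    (xp ^+ 2 / sigma p ^+ 4 + xm ^+ 2 / sigma p.+1 ^+ 4))%:E <=
   \sum_(0 <= k <oo) (eta k ^+ 4)%:E)%E.
Proof.
move=> a_gt0 a_incr s_gt0 C0 aC Hr Ha xp0 xm0 spm eta_in.
pose wp := (sigma p ^+ 4)^-1; pose wm := (sigma p.+1 ^+ 4)^-1.
have wp0 : 0 < wp by rewrite invr_gt0 exprn_gt0.
have wm0 : 0 < wm by rewrite invr_gt0 exprn_gt0.
(* Tangency at x* would ask for lp = wp xp; the extra [(1 + C) * lm] secures [lm + C * lm <= lp]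
   even when xp vanishes. *)
pose lm := wm * xm; pose lp := wp * xp + (1 + C) * lm.
have lm0 : 0 <= lm by rewrite mulr_ge0// ltW.
have wpx0 : 0 <= wp * xp by rewrite mulr_ge0// ltW.
have lplm : lm + C * lm <= lp by rewrite /lp; lra.
have lp0 : 0 <= lp by rewrite /lp addr_ge0// mulr_ge0// addr_ge0.
have [l [lpE lmE l0 lle lsum]] :=
  dual_weights sigma a_gt0 a_incr C0 aC Hr Ha lm0 lplm.
apply: (le_trans _ (ge0_series_le_partial p.+2 _)); last first.
  by move=> k; rewrite exprn_even_ge0.
rewrite lee_fin.
(* [eta^4 >= 2 b eta^2 - b^2] with [b = l sigma^2] *)
apply: (@le_trans _ _ (\sum_(0 <= k < p.+2)
   (2 * (l k * sigma k ^+ 2 * eta k ^+ 2) - l k ^+ 2 * sigma k ^+ 4))); last first.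
  apply: ler_sum => k _; rewrite -subr_ge0.
  rewrite (_ : _ - _ = (eta k ^+ 2 - l k * sigma k ^+ 2) ^+ 2) ?sqr_ge0//.
  ring.
rewrite sumrB -mulr_sumr.
have {lsum} := lsum _ eta_in.
set G := \sum_(0 <= k < p.+2) _ => lsum.
rewrite !big_nat_recr//= lpE lmE.
set S4 := (\sum_(0 <= k < p) sigma k ^+ 4).
have Hhead : \sum_(0 <= k < p) l k ^+ 2 * sigma k ^+ 4 <=
    (1 + C) ^+ 2 * lp ^+ 2 * S4.
  rewrite mulr_sumr !big_nat; apply: ler_sum => k kp.
  rewrite ler_wpM2r ?exprn_even_ge0// -exprMn lerXn2r ?nnegrE//.
    by rewrite l0// (leq_trans kp)// -addn2 leq_addr.
    by rewrite mulr_ge0// addr_ge0.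
  exact: lle.
have S40 : 0 <= S4 by rewrite sumr_ge0// => k _; rewrite exprn_even_ge0.
set rho := (sigma p / sigma p.+1) ^+ 4.
have rhoE : rho * wp = wm.
  by rewrite /rho /wp /wm; field; rewrite !gt_eqF.
have rho0 : 0 <= rho by rewrite exprn_even_ge0.
have rho1 : rho <= 1.
  rewrite /rho exprn_ile1// ?divr_ge0 ?(ltW (s_gt0 _))//.
  by rewrite ler_pdivrMr// mul1r.
have sp4 : sigma p ^+ 4 = wp^-1 by rewrite invrK.
have sm4 : sigma p.+1 ^+ 4 = wm^-1 by rewrite invrK.
clearbody wp wm.
rewrite sp4 sm4 !invrK.
have wpI : wp * wp^-1 = 1 by rewrite divff// gt_eqF.
pose F := xp ^+ 2 * wp + xm ^+ 2 * wm.
(* The middle term cancels against the contribution of [(1 + C) * lm] to 2 lp xp; the last term is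
   the loss with factor [rho]. *)
have lp2 : lp ^+ 2 * wp^-1 = xp ^+ 2 * wp + 2 * (1 + C) * xp * (wm * xm)
    + (1 + C) ^+ 2 * rho * (wm * xm ^+ 2).
  rewrite /lp /lm -rhoE; field; exact: lt0r_neq0.
have lm2 : lm ^+ 2 * wm^-1 = wm * xm ^+ 2.
  by rewrite /lm; field; exact: lt0r_neq0.
(* Uses (u + v)^2 <= 2 (u^2 + v^2) and wm = rho wp <= wp. *)
have lp2le : lp ^+ 2 <= 2 * (1 + C) ^+ 2 * (wp * F).
  apply: (@le_trans _ _ (2 * ((wp * xp) ^+ 2 + ((1 + C) * lm) ^+ 2))).
    rewrite /lp; have := sqr_ge0 (wp * xp - (1 + C) * lm); nra.
  rewrite -mulrA ler_pM2l// /F mulrDr mulrDr lerD//.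
    rewrite (_ : (wp * xp) ^+ 2 = 1 * (wp * (xp ^+ 2 * wp))); last by ring.
    rewrite ler_wpM2r ?exprn_ege1//; last by lra.
    by rewrite mulr_ge0 ?mulr_ge0 ?sqr_ge0// ltW.
  rewrite exprMn ler_wpM2l ?sqr_ge0// /lm.
  rewrite (_ : (wm * xm) ^+ 2 = wm * (wm * xm ^+ 2)); last by ring.
  rewrite (mulrC (xm ^+ 2)) ler_wpM2r ?mulr_ge0 ?sqr_ge0 ?(ltW wm0)//.
  by rewrite -rhoE ler_piMl// ltW.
have F0 : 0 <= F by rewrite addr_ge0// mulr_ge0 ?sqr_ge0// ltW.
have Hhead2 : (1 + C) ^+ 2 * lp ^+ 2 * S4 <= 2 * (1 + C) ^+ 4 * (S4 * wp) * F.
  have := ler_wpM2l (mulr_ge0 (sqr_ge0 (1 + C)) S40) lp2le.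
  rewrite (_ : _ * (2 * _ * _) = 2 * (1 + C) ^+ 4 * (S4 * wp) * F); last by ring.
  by rewrite mulrAC.
rewrite lp2 lm2 -/F.
have : (1 + C) ^+ 2 * rho * (wm * xm ^+ 2) <= (1 + C) ^+ 2 * rho * F.
  have c0 : 0 <= (1 + C) ^+ 2 * rho by rewrite mulr_ge0 ?sqr_ge0.
  apply: (ler_wpM2l c0); rewrite /F (mulrC wm) lerDr.
  by rewrite mulr_ge0 ?sqr_ge0// ltW.
move: lsum; rewrite /lp.
have -> : (1 - ((1 + C) ^+ 2 * rho + 2 * (1 + C) ^+ 4 * (S4 * wp))) * F =
   F - (1 + C) ^+ 2 * rho * F - 2 * (1 + C) ^+ 4 * (S4 * wp) * F by ring.
have FE : F = xp ^+ 2 * wp + xm ^+ 2 * wm by [].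
clearbody F rho S4 G; rewrite /lm; lra.
Qed.

(** For the weights sigma_k^-2 the margin required by [dual_weights] is the smallness hypothesis on
    [sigma p / sigma p.+1]. The products g = l sigma^2 equal 1 at [p] and at [p.+1], which accounts
    for the 2; the bound on their sum later keeps the errors of the test uniform in [p]. *)
Lemma quadratic_lower_bound {R : realType} (a sigma : nat -> R)
    (r xp xm C : R) p :
  (forall k, 0 < a k) -> nondecreasing_seq a -> (forall k, 0 < sigma k) ->
  0 <= C ->
  (forall k, (p <= k)%N -> a k ^+ 2 <= C * (a k.+1 ^+ 2 - a k ^+ 2)) ->
  xp + xm = r ^+ 2 -> a p ^+ 2 * xp + a p.+1 ^+ 2 * xm = 1 ->
  (1 + C) * (sigma p / sigma p.+1) ^+ 2 <= 1 ->
  exists g : nat -> R,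
    [/\ forall k, (k < p.+2)%N -> 0 <= g k,
        \sum_(0 <= k < p.+2) g k <= 2 + (1 + C) *
          ((\sum_(0 <= k < p) sigma k ^+ 2) / sigma p ^+ 2) &
        forall eta, Theta2r a sigma r eta ->
          xp / sigma p ^+ 2 + xm / sigma p.+1 ^+ 2 <=
            \sum_(0 <= k < p.+2) g k * eta k ^+ 2].
Proof.
move=> a_gt0 a_incr s_gt0 C0 aC Hr Ha hs.
pose lp := (sigma p ^+ 2)^-1; pose lm := (sigma p.+1 ^+ 2)^-1.
have lm0 : 0 <= lm by rewrite invr_ge0 sqr_ge0.
have lplm : lm + C * lm <= lp.
  have lp0 : 0 <= lp by rewrite invr_ge0 sqr_ge0.
  have := ler_wpM2r lp0 hs; rewrite mul1r; apply: le_trans.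
  rewrite (_ : _ * lp = lm + C * lm)// /lp /lm.
  by field; rewrite !gt_eqF.
have [l [lpE lmE l0 lle lsum]] :=
  dual_weights sigma a_gt0 a_incr C0 aC Hr Ha lm0 lplm.
exists (fun k => l k * sigma k ^+ 2); split.
- by move=> k kp; rewrite mulr_ge0 ?sqr_ge0 ?l0.
- rewrite !big_nat_recr//= lpE lmE /lp /lm !mulVf ?gt_eqF ?exprn_gt0//.
  rewrite -addrA addrC -[1 + 1]/2 lerD2l.
  rewrite mulrA mulrAC mulr_sumr !big_nat; apply: ler_sum => k kp.
  by rewrite ler_wpM2r ?sqr_ge0 ?lle.
- move=> eta /lsum; rewrite /lp /lm.
  by rewrite (mulrC _ xp) (mulrC _ xm).
Qed.

(** Any q > 1 below the lower limit satisfies a_(k+1) > q a_k for large k, so C = 1 / (q^2 - 1)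
    works; q = 2 is taken when the lower limit is infinite. *)
Lemma ratio_gap {R : realType} (a : nat -> R) (c : \bar R) :
  (forall k, 0 < a k) -> limn_einf (fun k => (a k.+1 / a k)%:E) = c ->
  (1%:E < c)%E ->
  exists2 C : R, 0 <= C &
    \forall k \near \oo, a k ^+ 2 <= C * (a k.+1 ^+ 2 - a k ^+ 2).
Proof.
move=> a_gt0 <- c_gt1.
have [q q1 qlim] : exists2 q : R, 1 < q &
    (q%:E < limn_einf (fun k => (a k.+1 / a k)%:E))%E.
  move: c_gt1; set l := limn_einf _.
  case: l => [l| |//] l1.
    move: l1; rewrite lte_fin => l1; exists ((1 + l) / 2); first by lra.
    by rewrite lte_fin; lra.
  by exists 2; [lra|rewrite ltry].
have q2 : 0 < q ^+ 2 - 1 by rewrite subr_gt0 exprn_egt1// ltW.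
exists (q ^+ 2 - 1)^-1; first by rewrite invr_ge0 ltW.
move: qlim; rewrite limn_einf_lim => qlim.
(* The lower limit is the limit of the tail infima [einfs]; were they all at most q, so would be the
   limit. *)
have [n hn] : exists n, (q%:E < einfs (fun k => (a k.+1 / a k)%:E) n)%E.
  apply: contrapT => /forallNP H; move: qlim; apply/negP; rewrite -leNgt.
  apply: lime_le; first exact: is_cvg_einfs.
  by apply: nearW => n; rewrite leNgt; apply/negP; exact: H.
exists n => // k /= nk.
have : (q%:E < (a k.+1 / a k)%:E)%E.
  apply: (lt_le_trans hn); apply: ereal_inf_lbound.
  by exists k.
rewrite lte_fin ltr_pdivlMr// => qa.
rewrite mulrC ler_pdivlMr// mulrBr mulr1 lerD2r mulrC -exprMn.
by rewrite lerXn2r ?nnegrE ?mulr_ge0 ?(ltW qa)// ?ltW//; apply: lt_trans q1.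
Qed.

(** Once r is below 1/a_(N+1), the inequality 1/a_m <= r and the monotonicity of [a] force m > N +
    1. The index [p] is m - 1, and the two bounds on r appear squared. *)
Lemma m_choice_cvg {R : realType} (a : nat -> R) (m : R -> nat) (r : R -> R) :
  (forall k, 0 < a k) -> nondecreasing_seq a -> m_choice a m ->
  (forall eps : R, 0 < eps -> 0 < r eps) ->
  r eps @[eps --> (0 : R)^'+] --> (0 : R) ->
  forall N, \forall eps \near (0 : R)^'+,
    exists2 p, (N <= p)%N &
      [/\ m (r eps) = p.+1, a p ^+ 2 * r eps ^+ 2 <= 1 &
          1 <= a p.+1 ^+ 2 * r eps ^+ 2].
Proof.
move=> a_gt0 a_incr m_spec r_gt0 r_to0 N.
near=> eps.
have eps0 : 0 < eps by near: eps; exact: nbhs_right_gt.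
have r0 := r_gt0 _ eps0.
have rN : r eps < (a N.+1)^-1.
  by near: eps; apply: (cvgr_lt 0) => //; rewrite invr_gt0.
have ra0 : r eps < (a 0%N)^-1.
  by rewrite (lt_le_trans rN)// lef_pV2 ?posrE// a_incr.
have := m_spec (r eps); rewrite r0 ra0 => /(_ isT).
case: (m (r eps)) => [[]//|p [_ /= /andP[h1 h2]]].
exists p; last split => //.
- rewrite -ltnS; rewrite ltnNge; apply/negP => pN.
  have := le_lt_trans h1 rN; rewrite ltf_pV2 ?posrE// ltNge => /negP; apply.
  by apply: a_incr; exact: leqW.
- rewrite -exprMn exprn_ile1 ?mulr_ge0 ?(ltW r0) ?(ltW (a_gt0 _))//.
  by rewrite -ler_pdivlMl// mulr1.
- rewrite -exprMn exprn_ege1//.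
  by rewrite -ler_pdivrMl// mulr1.
Unshelve. all: by end_near. Qed.

(** * The extremal sequence and its functionals *)

Section two_weights.
Context {R : realType}.
Variables (a sigma : nat -> R) (m : R -> nat) (eps r : R) (p : nat).
Hypotheses (eps_gt0 : 0 < eps) (r_gt0 : 0 < r).
Hypotheses (a_lt : 0 < a p.+1 ^+ 2 - a p ^+ 2) (sigma_gt0 : forall k, 0 < sigma k).
Hypotheses (mE : m r = p.+1) (rl : a p ^+ 2 * r ^+ 2 <= 1)
  (rr : 1 <= a p.+1 ^+ 2 * r ^+ 2).

(* The coordinates [m - 1] and [m] of x*. *)
Definition xstar_l : R :=
  (a p.+1 ^+ 2 * r ^+ 2 - 1) / (a p.+1 ^+ 2 - a p ^+ 2).
Definition xstar_r : R :=
  (1 - a p ^+ 2 * r ^+ 2) / (a p.+1 ^+ 2 - a p ^+ 2).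

Lemma xstar_l_ge0 : 0 <= xstar_l. Proof. by rewrite divr_ge0 ?(ltW a_lt)// subr_ge0. Qed.
Lemma xstar_r_ge0 : 0 <= xstar_r. Proof. by rewrite divr_ge0 ?(ltW a_lt)// subr_ge0. Qed.
Lemma xstarD : xstar_l + xstar_r = r ^+ 2.
Proof. by rewrite /xstar_l /xstar_r; field; rewrite gt_eqF. Qed.
Lemma a_xstarD : a p ^+ 2 * xstar_l + a p.+1 ^+ 2 * xstar_r = 1.
Proof. by rewrite /xstar_l /xstar_r; field; rewrite gt_eqF. Qed.

Definition eta_star : nat -> R :=
  two_point p (Num.sqrt xstar_l / sigma p) (Num.sqrt xstar_r / sigma p.+1).

Lemma eta_star_l : eta_star p ^+ 2 = xstar_l / sigma p ^+ 2.
Proof. by rewrite /eta_star two_pointl expr_div_n sqr_sqrtr ?xstar_l_ge0. Qed.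

Lemma eta_star_r : eta_star p.+1 ^+ 2 = xstar_r / sigma p.+1 ^+ 2.
Proof. by rewrite /eta_star two_pointr expr_div_n sqr_sqrtr ?xstar_r_ge0. Qed.

Lemma eta_star_in : Theta2r a sigma r eta_star.
Proof.
have hl : sigma p ^+ 2 * (Num.sqrt xstar_l / sigma p) ^+ 2 = xstar_l.
  rewrite expr_div_n sqr_sqrtr ?xstar_l_ge0// mulrC divfK//.
  by rewrite gt_eqF// exprn_gt0.
have hr : sigma p.+1 ^+ 2 * (Num.sqrt xstar_r / sigma p.+1) ^+ 2 = xstar_r.
  rewrite expr_div_n sqr_sqrtr ?xstar_r_ge0// mulrC divfK//.
  by rewrite gt_eqF// exprn_gt0.
by apply: two_point_Theta2r; rewrite hl hr ?xstarD ?a_xstarD.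
Qed.

(** The quartic objective at [eta_star], expressed through x*. *)
Definition F_star : R := xstar_l ^+ 2 / sigma p ^+ 4 + xstar_r ^+ 2 / sigma p.+1 ^+ 4.

(** The coordinates of x* add up to r^2 > 0, so at least one of them is positive. *)
Lemma F_star_gt0 : 0 < F_star.
Proof.
have h0 : 0 <= xstar_l ^+ 2 / sigma p ^+ 4.
  by rewrite divr_ge0 ?sqr_ge0// exprn_even_ge0.
have h1 : 0 <= xstar_r ^+ 2 / sigma p.+1 ^+ 4.
  by rewrite divr_ge0 ?sqr_ge0// exprn_even_ge0.
have [w0|w0] := eqVneq xstar_l 0.
  rewrite ltr_wpDl// divr_gt0 ?exprn_gt0//.
  by have := xstarD; rewrite w0 add0r => ->; rewrite exprn_gt0.
by rewrite ltr_pwDl// divr_gt0 ?exprn_gt0// lt0r w0 xstar_l_ge0.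
Qed.

Lemma F_starE :
  F_star = (eta_star p ^+ 2) ^+ 2 + (eta_star p.+1 ^+ 2) ^+ 2.
Proof.
rewrite eta_star_l eta_star_r (expr_div_n xstar_l) (expr_div_n xstar_r).
by rewrite -(exprM (sigma p) 2 2) -(exprM (sigma p.+1) 2 2).
Qed.

Lemma quartic_eta_star :
  (\sum_(0 <= k <oo) (eta_star k ^+ 4)%:E = F_star%:E)%E.
Proof.
rewrite (@two_point_series _ (fun k => eta_star k ^+ 4) p).
- by rewrite F_starE (exprM (eta_star p) 2 2) (exprM (eta_star p.+1) 2 2).
- by move=> k; rewrite exprn_even_ge0.
- by move=> k kp kp1; rewrite /eta_star two_point0// expr0n.
Qed.

Lemma u_starE : u_star a sigma m eps r = Num.sqrt ((2 * eps ^+ 4)^-1 * F_star).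
Proof.
rewrite /u_star mE /= /F_star /xstar_l /xstar_r; congr Num.sqrt.
by field; rewrite !gt_eqF.
Qed.

Lemma u_linE : u_lin a sigma m eps r =
  (eta_star p ^+ 2 + eta_star p.+1 ^+ 2) / eps ^+ 2.
Proof.
rewrite /u_lin mE /= eta_star_l eta_star_r /xstar_l /xstar_r.
by field; rewrite !gt_eqF.
Qed.

Lemma u_star_gt0 : 0 < u_star a sigma m eps r.
Proof.
rewrite u_starE sqrtr_gt0 mulr_gt0 ?F_star_gt0// invr_gt0 mulr_gt0//.
by rewrite exprn_gt0.
Qed.

Lemma u_lin_ge0 : 0 <= u_lin a sigma m eps r.
Proof. by rewrite u_linE divr_ge0 ?addr_ge0 ?sqr_ge0. Qed.

(** With y, z the squared coordinates of [eta_star], the differences of the squares of the two sides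
    are ((y - z) / (2 eps^2))^2 and y z / eps^4. *)
Lemma u_lin_u_star : u_lin a sigma m eps r / 2 <= u_star a sigma m eps r <=
  u_lin a sigma m eps r / Num.sqrt 2.
Proof.
have yl0 := sqr_ge0 (eta_star p); have yr0 := sqr_ge0 (eta_star p.+1).
have e2 : 0 < eps ^+ 2 by rewrite exprn_gt0.
have us0 := ltW u_star_gt0; have ul0 := u_lin_ge0.
have us2 : u_star a sigma m eps r ^+ 2 = (2 * eps ^+ 4)^-1 * F_star.
  rewrite u_starE sqr_sqrtr// mulr_ge0 ?(ltW F_star_gt0)// invr_ge0.
  by rewrite mulr_ge0// exprn_even_ge0.
have e4 : eps ^+ 4 = (eps ^+ 2) ^+ 2 by rewrite -exprM.
apply/andP; split.
- rewrite -(@ler_pXn2r _ 2) ?nnegrE//; last by rewrite divr_ge0.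
  rewrite us2 u_linE F_starE e4.
  move: (eta_star p ^+ 2) (eta_star p.+1 ^+ 2) (eps ^+ 2) yl0 yr0 e2.
  move=> y z e y0 z0 e0.
  rewrite -subr_ge0 (_ : _ - _ = ((y - z) / e / 2) ^+ 2) ?sqr_ge0//.
  by field; rewrite gt_eqF.
- rewrite -(@ler_pXn2r _ 2) ?nnegrE//; last by rewrite divr_ge0// sqrtr_ge0.
  rewrite us2 u_linE F_starE e4 expr_div_n sqr_sqrtr//.
  move: (eta_star p ^+ 2) (eta_star p.+1 ^+ 2) (eps ^+ 2) yl0 yr0 e2.
  move=> y z e y0 z0 e0.
  rewrite -subr_ge0 (_ : _ - _ = y * z / e ^+ 2).
    by rewrite divr_ge0 ?sqr_ge0// mulr_ge0.
  by field; rewrite gt_eqF.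
Qed.

Lemma u_eps_bounds (k : R) : 0 <= 1 - k ->
  (forall eta, Theta2r a sigma r eta ->
     ((1 - k) * F_star)%:E <= \sum_(0 <= k <oo) (eta k ^+ 4)%:E)%E ->
  Num.sqrt (1 - k) * u_star a sigma m eps r <= u_eps a sigma eps r <=
    u_star a sigma m eps r.
Proof.
move=> k1 lb; rewrite /u_eps; set S := [set _ | _ in _].
have infl : (((1 - k) * F_star)%:E <= ereal_inf S)%E.
  by apply: le_ereal_inf_tmp => _ [eta etain <-]; exact: lb.
have infr : (ereal_inf S <= F_star%:E)%E.
  apply: ereal_inf_lbound; exists eta_star; first exact: eta_star_in.
  exact: quartic_eta_star.
(* [fine] would send an infinite infimum to 0; the two bounds exclude this. *)
have inffin : ereal_inf S \is a fin_num.
  by rewrite fin_numElt (lt_le_trans _ infl) ?ltNyr//= (le_lt_trans infr)// ltry.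
rewrite -(fineK inffin) !lee_fin in infl infr.
have e0 : 0 <= (2 * eps ^+ 4)^-1.
  by rewrite invr_ge0 mulr_ge0// exprn_even_ge0.
rewrite u_starE -sqrtrM// !ler_wsqrtr// ?ler_wpM2l//.
by rewrite mulrCA ler_wpM2l.
Qed.

End two_weights.

(** * Limits as [p] grows and as [eps] decreases to 0 *)

Lemma sigma_ratio_cvg0 {R : realType} (sigma : nat -> R) n :
  (forall k, 0 < sigma k) ->
  sigma k.+1 / sigma k @[k --> \oo] --> +oo ->
  (sigma k / sigma k.+1) ^+ n.+1 @[k --> \oo] --> (0 : R).
Proof.
move=> s_gt0 /gtr0_cvgV0 h.
have {}h : sigma k / sigma k.+1 @[k --> \oo] --> (0 : R).
  rewrite (_ : (fun k => _) = (fun k => (sigma k.+1 / sigma k)^-1)); last first.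
    by apply/funext => k; rewrite invf_div.
  by apply: h; apply: nearW => k; rewrite divr_gt0.
have := @continuous_cvg _ _ _ \oo _ _ (fun x : R => x ^+ n.+1) _
  (@exprn_continuous R n.+1 0) h.
by rewrite expr0n /=; exact.
Qed.

Lemma sigma_power_sum_cvg0 {R : realType} (sigma : nat -> R) n :
  (forall k, 0 < sigma k) ->
  sigma k.+1 / sigma k @[k --> \oo] --> +oo ->
  (\sum_(0 <= k < p) sigma k ^+ n.+1) / sigma p ^+ n.+1 @[p --> \oo] --> (0 : R).
Proof.
move=> s_gt0 s_ratio; apply: ratio_sum_cvg0.
  by move=> k; rewrite exprn_gt0.
have := @sigma_ratio_cvg0 _ _ n s_gt0 s_ratio.
by under eq_fun do rewrite expr_div_n.
Qed.

Section asymptotics.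
Context {R : realType}.
Variables (a sigma : nat -> R) (c : \bar R) (m : R -> nat) (r : R -> R).
Hypotheses (a_gt0 : forall k, 0 < a k) (a_incr : nondecreasing_seq a)
  (sigma_gt0 : forall k, 0 < sigma k) (sigma_incr : nondecreasing_seq sigma)
  (sigma_ratio : sigma k.+1 / sigma k @[k --> \oo] --> +oo)
  (a_ratio : limn_einf (fun k => (a k.+1 / a k)%:E) = c)
  (c_gt1 : (1%:E < c)%E)
  (m_spec : m_choice a m)
  (r_gt0 : forall eps : R, 0 < eps -> 0 < r eps)
  (r_to0 : r eps @[eps --> (0 : R)^'+] --> (0 : R)).

(** Turns what holds for all large [p] into a property of m - 1 for all small [eps], since m tends
    to infinity. *)
Lemma near_m_choice (Q : nat -> Prop) : (\forall p \near \oo, Q p) ->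
  \forall eps \near (0 : R)^'+, exists p,
    [/\ m (r eps) = p.+1, a p ^+ 2 * r eps ^+ 2 <= 1,
        1 <= a p.+1 ^+ 2 * r eps ^+ 2 & Q p].
Proof.
move=> [N _ NQ].
have := m_choice_cvg a_gt0 a_incr m_spec r_gt0 r_to0 N.
by apply: filterS => eps [p Np [? ? ?]]; exists p; split => //; exact: NQ.
Qed.

Lemma near_gap : exists2 C : R, 0 <= C &
  \forall p \near \oo, forall k, (p <= k)%N ->
    a k ^+ 2 <= C * (a k.+1 ^+ 2 - a k ^+ 2).
Proof.
have [C C0 [N _ NC]] := ratio_gap a_gt0 a_ratio c_gt1.
exists C => //; exists N => // p /= Np k pk; apply: NC => /=.
exact: leq_trans pk.
Qed.

Lemma gap_gt0 (C : R) p : 0 <= C ->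
  a p ^+ 2 <= C * (a p.+1 ^+ 2 - a p ^+ 2) -> 0 < a p.+1 ^+ 2 - a p ^+ 2.
Proof.
move=> C0 aC; have : 0 < C * (a p.+1 ^+ 2 - a p ^+ 2).
  by apply: lt_le_trans aC; rewrite exprn_gt0.
move: C0; rewrite le_eqVlt => /predU1P[<-|C0]; first by rewrite mul0r ltxx.
by rewrite pmulr_rgt0.
Qed.

Lemma u_eps_near (d : R) : 0 < d -> d <= 1 ->
  \forall eps \near (0 : R)^'+,
    [/\ 0 < u_star a sigma m eps (r eps),
       Num.sqrt (1 - d) * u_star a sigma m eps (r eps) <=
         u_eps a sigma eps (r eps),
       u_eps a sigma eps (r eps) <= u_star a sigma m eps (r eps) &
       u_lin a sigma m eps (r eps) / 2 <= u_star a sigma m eps (r eps) <=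
         u_lin a sigma m eps (r eps) / Num.sqrt 2].
Proof.
move=> d0 d1; have [C C0 gap] := near_gap.
(* The relative loss in [quartic_lower_bound]; both of its terms vanish because the ratios of
   [sigma] diverge. *)
pose kappa p : R := (1 + C) ^+ 2 * (sigma p / sigma p.+1) ^+ 4 +
  2 * (1 + C) ^+ 4 * ((\sum_(0 <= k < p) sigma k ^+ 4) / sigma p ^+ 4).
have kappa0 : kappa p @[p --> \oo] --> (0 : R).
  rewrite -[X in _ --> X](addr0 0).
  rewrite -[X in _ --> X + _](mulr0 ((1 + C) ^+ 2)).
  rewrite -[X in _ --> _ + X](mulr0 (2 * (1 + C) ^+ 4)).
  apply: cvgD; apply: cvgMl_tmp; first exact: sigma_ratio_cvg0.
  exact: sigma_power_sum_cvg0.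
have kappad : \forall p \near \oo, kappa p <= d.
  by near=> p; apply/ltW; near: p; exact: (cvgr_lt 0).
near=> eps.
have eps0 : 0 < eps by near: eps; exact: nbhs_right_gt.
have [p [mE hl hr [pgap pk]]] : exists p,
    [/\ m (r eps) = p.+1, a p ^+ 2 * r eps ^+ 2 <= 1,
        1 <= a p.+1 ^+ 2 * r eps ^+ 2 &
      (forall k, (p <= k)%N -> a k ^+ 2 <= C * (a k.+1 ^+ 2 - a k ^+ 2)) /\
      kappa p <= d].
  near: eps; exact: near_m_choice (filterI gap kappad).
have r0 := r_gt0 eps0.
have D0 := gap_gt0 C0 (pgap p (leqnn p)).
have F0 : 0 < F_star a sigma (r eps) p by exact: F_star_gt0.
have [h1 h2] : Num.sqrt (1 - d) * u_star a sigma m eps (r eps) <=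
    u_eps a sigma eps (r eps) /\
    u_eps a sigma eps (r eps) <= u_star a sigma m eps (r eps).
  apply/andP; apply: (u_eps_bounds (p := p)) => //; first by rewrite subr_ge0.
  move=> eta etain.
  apply: le_trans (quartic_lower_bound a_gt0 a_incr sigma_gt0 C0 pgap
    (xstarD _ D0) (a_xstarD _ D0) (xstar_l_ge0 D0 hr) (xstar_r_ge0 D0 hl)
    (sigma_incr (leqnSn p)) etain).
  by rewrite lee_fin -/(kappa p) ler_wpM2r ?(ltW F0)// lerD2l lerN2.
split => //.
- exact: (u_star_gt0 (p := p)).
- exact: (u_lin_u_star (p := p)).
Unshelve. all: by end_near. Qed.

Lemma u_eps_equiv_u_star :
  u_eps a sigma eps (r eps) / u_star a sigma m eps (r eps)
    @[eps --> (0 : R)^'+] --> (1 : R).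
Proof.
apply/cvgrPdist_le => e e0.
pose d := Num.min e 1.
have d0 : 0 < d by rewrite lt_min e0/=.
have d1 : d <= 1 by rewrite ge_min lexx orbT.
have := u_eps_near d0 d1; apply: filterS => eps [us0 h1 h2 _].
have h3 : u_eps a sigma eps (r eps) / u_star a sigma m eps (r eps) <= 1.
  by rewrite ler_pdivrMr// mul1r.
rewrite ger0_norm ?subr_ge0// lerBlDl -lerBlDr.
rewrite ler_pdivlMr//; apply: le_trans h1; rewrite ler_pM2r//.
apply: (@le_trans _ _ (1 - d)).
  by rewrite lerD2l lerN2 ge_min lexx.
(* 1 - d <= sqrt (1 - d), because 1 - d lies in [0, 1]. *)
rewrite -[leLHS]sqr_sqrtr ?subr_ge0// expr2 ler_piMr ?sqrtr_ge0//.
by rewrite -[leRHS]sqrtr1 ler_wsqrtr// gerBl ltW.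
Qed.

Lemma u_eps_rate : exists o1 o2 : R -> R,
  [/\ o1 eps @[eps --> (0 : R)^'+] --> (0 : R),
      o2 eps @[eps --> (0 : R)^'+] --> (0 : R) &
      \forall eps \near (0 : R)^'+,
        u_lin a sigma m eps (r eps) * (2^-1 + o1 eps)
          <= u_eps a sigma eps (r eps)
          <= u_lin a sigma m eps (r eps) * ((Num.sqrt 2)^-1 + o2 eps)].
Proof.
pose rho eps := u_eps a sigma eps (r eps) / u_star a sigma m eps (r eps).
(* Chosen so that 1/2 + o1 = rho / 2: multiplying u_lin / 2 <= u_star by rho gives the left
   inequality. The right one holds without error term, from u_eps <= u_star. *)
exists (fun eps => (rho eps - 1) / 2), (fun=> 0); split.
- have : (rho eps - 1) / 2 @[eps --> (0 : R)^'+] --> ((1 - 1) / 2 : R).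
    by apply: cvgMr_tmp; apply: cvgB; [exact: u_eps_equiv_u_star|exact: cvg_cst].
  by rewrite subrr mul0r.
- exact: cvg_cst.
(* With d = 1 the lower bound reduces to 0 <= u_eps, which is all that the sign of rho requires. *)
- have := u_eps_near ltr01 (lexx 1).
  apply: filterS => eps [us0 h1 h2 /andP[h3 h4]].
  rewrite addr0 (le_trans h2 h4) andbT.
  have -> : u_eps a sigma eps (r eps) = rho eps * u_star a sigma m eps (r eps).
    by rewrite divfK// gt_eqF.
  rewrite (_ : _ * (_ + _) = rho eps * (u_lin a sigma m eps (r eps) / 2)).
    rewrite ler_wpM2l// divr_ge0 ?(ltW us0)//; apply: le_trans h1.
    by rewrite mulr_ge0 ?sqrtr_ge0// ltW.
  by field.
Qed.

(** The only facts about the extreme problem that enter the statistical part: [g] defines the test,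
    and [eta0] is the alternative that is hard to detect. The bound S does not depend on [eps]. *)
Lemma near_test_weights : exists2 S : R, 0 < S &
  \forall eps \near (0 : R)^'+, exists p (g eta0 : nat -> R),
    [/\ [/\ forall k, 0 <= g k,
        \sum_(0 <= k < p.+2) g k <= S &
        forall eta, Theta2r a sigma (r eps) eta ->
          eps ^+ 2 * u_lin a sigma m eps (r eps) <=
            \sum_(0 <= k < p.+2) g k * eta k ^+ 2],
        Theta2r a sigma (r eps) eta0,
        forall k, (p.+2 <= k)%N -> eta0 k = 0 &
        \sum_(0 <= k < p.+2) eta0 k ^+ 2 =
          eps ^+ 2 * u_lin a sigma m eps (r eps)].
Proof.
have [C C0 gap] := near_gap.
have C1 : 0 < 1 + C by rewrite ltr_pwDl.
(* This is 2 + (1 + C) * 1: the normalized sum of the sigma_k^2 below [p] is eventually at most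
   1. *)
exists (3 + C); first by rewrite ltr_pwDl.
have h1 : \forall p \near \oo, (1 + C) * (sigma p / sigma p.+1) ^+ 2 <= 1.
  near=> p; rewrite mulrC -ler_pdivlMr// mul1r.
  apply/ltW; near: p; apply: (cvgr_lt 0); first exact: sigma_ratio_cvg0.
  by rewrite invr_gt0.
have h2 : \forall p \near \oo,
    (\sum_(0 <= k < p) sigma k ^+ 2) / sigma p ^+ 2 <= 1.
  near=> p; apply/ltW; near: p; apply: (cvgr_lt 0) => //.
  exact: sigma_power_sum_cvg0.
near=> eps.
have eps0 : 0 < eps by near: eps; exact: nbhs_right_gt.
have [p [mE hl hr [[pgap p1] p2]]] : exists p,
    [/\ m (r eps) = p.+1, a p ^+ 2 * r eps ^+ 2 <= 1,
        1 <= a p.+1 ^+ 2 * r eps ^+ 2 &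
      ((forall k, (p <= k)%N -> a k ^+ 2 <= C * (a k.+1 ^+ 2 - a k ^+ 2)) /\
      (1 + C) * (sigma p / sigma p.+1) ^+ 2 <= 1) /\
      (\sum_(0 <= k < p) sigma k ^+ 2) / sigma p ^+ 2 <= 1].
  near: eps; exact: near_m_choice (filterI (filterI gap h1) h2).
have r0 := r_gt0 eps0.
have D0 := gap_gt0 C0 (pgap p (leqnn p)).
have [g [g0 gS gle]] := quadratic_lower_bound a_gt0 a_incr sigma_gt0 C0 pgap
    (xstarD (r eps) D0) (a_xstarD (r eps) D0) p1.
have uE : eps ^+ 2 * u_lin a sigma m eps (r eps) =
    xstar_l a (r eps) p / sigma p ^+ 2 + xstar_r a (r eps) p / sigma p.+1 ^+ 2.
  rewrite (u_linE eps0 D0 sigma_gt0 mE hl hr).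
  rewrite (eta_star_l _ D0 hr) (eta_star_r _ D0 hl) mulrC divfK//.
  by rewrite gt_eqF// exprn_gt0.
(* The weights are known to be nonnegative only below [p.+2]; absolute values make them so
   everywhere without changing the sums. *)
have gN (v : nat -> R) : \sum_(0 <= k < p.+2) `|g k| * v k =
    \sum_(0 <= k < p.+2) g k * v k.
  by apply: eq_big_nat => k /andP[_ kp]; rewrite ger0_norm// g0.
exists p, (fun k => `|g k|), (eta_star a sigma (r eps) p); split; first split => //.
- have -> : \sum_(0 <= k < p.+2) `|g k| = \sum_(0 <= k < p.+2) g k.
    by apply: eq_big_nat => k /andP[_ kp]; rewrite ger0_norm// g0.
  apply: (le_trans gS); rewrite (_ : 3 + C = 2 + (1 + C) * 1); last by ring.
  by rewrite lerD2l ler_wpM2l// ltW.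
- by move=> eta /gle; rewrite uE gN.
- exact: eta_star_in.
- move=> k pk; rewrite /eta_star two_point0//.
    by rewrite gtn_eqF// (leq_trans _ pk)// leqnSn.
  by rewrite gtn_eqF.
- rewrite uE !big_nat_recr//= big_nat big1 ?add0r.
    by rewrite (eta_star_l _ D0 hr) (eta_star_r _ D0 hl).
  move=> k /andP[_ kp]; rewrite /eta_star two_point0 ?expr0n// ltn_eqF//.
  exact: ltnW.
Unshelve. all: by end_near. Qed.

End asymptotics.

(** * Measures with densities and Gaussian integrals *)

Section weighted_image.
Context d d' (T : measurableType d) (S : measurableType d') (R : realType).
Context (mu : {measure set T -> \bar R}) (X : T -> S) (F : T -> R).

(** The push-forward by [X] of the measure with density [F] against [mu]. The side conditions are
    arguments, so that the measure structure can be attached to the term. *)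
Definition weighted_image of measurable_fun setT X & measurable_fun setT F &
    (forall x, 0 <= F x) : set S -> \bar R :=
  fun A => (\int[mu]_(x in X @^-1` A) (F x)%:E)%E.

Hypotheses (mX : measurable_fun setT X) (mF : measurable_fun setT F)
  (F0 : forall x, 0 <= F x).

Local Notation nu := (weighted_image mX mF F0).

Let nu0 : nu set0 = 0%E.
Proof. by rewrite /weighted_image preimage_set0 integral_set0. Qed.

Let nu_ge0 A : (0 <= nu A)%E.
Proof. by apply: integral_ge0 => x _; rewrite lee_fin. Qed.

Let mpreimage A : measurable A -> measurable (X @^-1` A).
Proof. by move=> mA; rewrite -[_ @^-1` _]setTI; exact: mX. Qed.

Let nu_semi_sigma_additive : semi_sigma_additive nu.
Proof.
move=> A mA tA mUA.
rewrite /weighted_image preimage_bigcup ge0_integral_bigcup//.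
- apply: is_cvg_nneseries => n _ _.
  by apply: integral_ge0 => x _; rewrite lee_fin.
- by move=> k; exact: mpreimage.
- by apply/measurable_EFinP; exact: measurable_funTS.
- by move=> x _; rewrite lee_fin.
- move=> i j _ _ [x [Ai Aj]]; apply: tA => //.
  by exists (X x).
Qed.

HB.instance Definition _ := isMeasure.Build _ _ _ nu
  nu0 nu_ge0 nu_semi_sigma_additive.

Import HBNNSimple.

(** For indicators this is the definition; linearity gives simple functions, and monotone
    convergence on both sides gives the general case. *)
Lemma ge0_integral_weighted_image (f : S -> \bar R) :
  measurable_fun setT f -> (forall y, 0 <= f y)%E ->
  (\int[nu]_y f y = \int[mu]_x (f (X x) * (F x)%:E))%E.
Proof.
move=> mf f0; pose f_ := nnsfun_approx measurableT mf.
have mfX n : measurable_fun setT (fun x => f_ n (X x)).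
  by apply: measurableT_comp => //; exact: measurable_funP.
transitivity (limn (fun n => \int[nu]_y (f_ n y)%:E)%E).
  rewrite -monotone_convergence//.
  - apply: eq_integral => y _; apply/esym/cvg_lim => //.
    exact: cvg_nnsfun_approx.
  - by move=> n; exact/measurable_EFinP/measurable_funP.
  - by move=> n y _; rewrite lee_fin.
  - by move=> y _ k n kn; rewrite lee_fin; exact/lefP/nd_nnsfun_approx.
transitivity (limn (fun n => \int[mu]_x (f_ n (X x) * F x)%:E)%E); last first.
  rewrite -monotone_convergence//.
  - apply: eq_integral => x _; apply/cvg_lim => //.
    under eq_fun do rewrite EFinM.
    apply: cvgeZr => //; exact: cvg_nnsfun_approx.
  - by move=> n; apply/measurable_EFinP; exact: measurable_funM.
  - by move=> n x _; rewrite lee_fin mulr_ge0.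
  - move=> x _ k n kn; rewrite lee_fin ler_wpM2r//.
    exact/lefP/nd_nnsfun_approx.
congr (limn _); apply/funext => n.
rewrite integralT_nnsfun sintegralE.
transitivity (\sum_(k \in range (f_ n))
    \int[mu]_x (k * (\1_(f_ n @^-1` [set k]) (X x) * F x))%:E)%E; last first.
  rewrite -ge0_integral_fsum//.
  - apply: eq_integral => x _; rewrite fsumEFin//; congr EFin.
    under eq_fsbigr do rewrite mulrA.
    rewrite -mulr_fsuml.
    by congr (_ * _); exact/esym/fimfunE.
  - move=> k; apply/measurable_EFinP; apply: measurable_funM => //.
    by apply: measurable_funM => //; exact: measurableT_comp.
  - move=> k x _; rewrite lee_fin mulrA mulr_ge0//.
    exact: nnfun_muleindic_ge0.
apply: eq_fsbigr => k; rewrite inE => -[y _ <-].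
under eq_integral do rewrite EFinM.
rewrite ge0_integralZl_EFin//; last 2 first.
- by move=> x _; rewrite lee_fin mulr_ge0.
- apply/measurable_EFinP; apply: measurable_funM => //.
  exact: measurableT_comp.
congr (_ * _)%E; rewrite /= /weighted_image integral_mkcond.
apply: eq_integral => x _; rewrite patchE indicE.
case: ifPn => xA.
- by rewrite mem_set ?mul1r//; rewrite inE in xA.
- by rewrite memNset ?mul0r//; rewrite notin_setE in xA.
Qed.

End weighted_image.

Section weighted_image_unique.
Context d1 d2 d' (T1 : measurableType d1) (T2 : measurableType d2)
  (S : measurableType d') (R : realType).
Context (mu1 : {measure set T1 -> \bar R}) (mu2 : {measure set T2 -> \bar R}).
Variables (X1 : T1 -> S) (F1 : T1 -> R) (X2 : T2 -> S) (F2 : T2 -> R).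
Hypotheses (mX1 : measurable_fun setT X1) (mF1 : measurable_fun setT F1)
  (F10 : forall x, 0 <= F1 x).
Hypotheses (mX2 : measurable_fun setT X2) (mF2 : measurable_fun setT F2)
  (F20 : forall x, 0 <= F2 x).

(** Both integrals are integrals of [f] against weighted images that agree on measurable sets. This
    one device transfers the law of a variable and drives the induction for independence. *)
Lemma ge0_integral_weighted_eq (f : S -> \bar R) :
  (forall A, measurable A ->
    \int[mu1]_(x in X1 @^-1` A) (F1 x)%:E =
    \int[mu2]_(x in X2 @^-1` A) (F2 x)%:E)%E ->
  measurable_fun setT f -> (forall y, 0 <= f y)%E ->
  (\int[mu1]_x (f (X1 x) * (F1 x)%:E) = \int[mu2]_x (f (X2 x) * (F2 x)%:E))%E.
Proof.
move=> h mf f0.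
rewrite -(ge0_integral_weighted_image mu1 mX1 mF1 F10)//.
rewrite -(ge0_integral_weighted_image mu2 mX2 mF2 F20)//.
by apply: eq_measure_integral => A mA _; exact: h.
Qed.

(** Finite measures that agree on a generating pi-system containing the whole space coincide. *)
Lemma ge0_integral_weighted_eq_generated (G : set (set S)) (f : S -> \bar R) :
  measurable = <<s G >> -> setI_closed G -> G setT ->
  (\int[mu1]_x (F1 x)%:E < +oo)%E ->
  (forall A, G A ->
    \int[mu1]_(x in X1 @^-1` A) (F1 x)%:E =
    \int[mu2]_(x in X2 @^-1` A) (F2 x)%:E)%E ->
  measurable_fun setT f -> (forall y, 0 <= f y)%E ->
  (\int[mu1]_x (f (X1 x) * (F1 x)%:E) = \int[mu2]_x (f (X2 x) * (F2 x)%:E))%E.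
Proof.
move=> mG GI GT F1fin h; apply: ge0_integral_weighted_eq => A mA.
apply: (measure_unique G (fun=> setT) mG GI _ _
  (weighted_image mu1 mX1 mF1 F10) (weighted_image mu2 mX2 mF2 F20)) => //.
by rewrite bigcup_const//; exists 0%N.
Qed.

End weighted_image_unique.

(** * Normal densities *)

Section normal.
Context {R : realType}.
Local Notation leb := (@lebesgue_measure R).
Implicit Types (x t g : R).

Lemma normal_pdf1E t x :
  normal_pdf t 1 x = normal_peak 1 * expR (- (x - t) ^+ 2 / 2).
Proof. by rewrite normal_pdfE ?oner_neq0// /normal_fun expr1n. Qed.

Lemma normal_pdf_tilt t x :
  normal_pdf 0 1 x * expR (t * x - t ^+ 2 / 2) = normal_pdf t 1 x.
Proof.
rewrite !normal_pdf1E -mulrA -expRD; congr (_ * expR _).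
by rewrite subr0; field.
Qed.

(** Completing the square: x^2 + g (t + x)^2 = (1 + g) (x + g t / (1 + g))^2 + g t^2 / (1 + g). *)
Lemma normal_pdf_gauss g t x : 0 <= g ->
  normal_pdf 0 1 x * expR (- (g * (t + x) ^+ 2) / 2) =
  (Num.sqrt (1 + g))^-1 * expR (- (g * t ^+ 2) / (2 * (1 + g))) *
  normal_pdf (- (g * t) / (1 + g)) (Num.sqrt (1 + g))^-1 x.
Proof.
move=> g0; have g1 : 0 < 1 + g by rewrite ltr_pwDl.
have s0 : 0 < Num.sqrt (1 + g) by rewrite sqrtr_gt0.
have s2 : Num.sqrt (1 + g) ^+ 2 = 1 + g by rewrite sqr_sqrtr// ltW.
rewrite normal_pdf1E (@normal_pdfE _ _ (Num.sqrt (1 + g))^-1); last first.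
  by rewrite gt_eqF// invr_gt0.
rewrite /normal_fun /normal_peak.
rewrite exprVn s2 expr1n mul1r.
have -> : (Num.sqrt ((1 + g)^-1 * pi *+ 2))^-1 =
    Num.sqrt (1 + g) * (Num.sqrt (pi *+ 2 : R))^-1.
  rewrite -mulrnAr sqrtrM ?invr_ge0 ?(ltW g1)// invfM; congr (_ * _).
  by rewrite -sqrtrV ?invrK// invr_ge0 ltW.
rewrite -[LHS]mulrA -expRD.
rewrite [RHS](_ : _ = (Num.sqrt (pi *+ 2))^-1 *
  (expR (- (g * t ^+ 2) / (2 * (1 + g))) *
   expR (- (x - - (g * t) / (1 + g)) ^+ 2 / ((1 + g)^-1 *+ 2)))); last first.
  move: (expR _) (expR _) => u v.
  by field; rewrite (gt_eqF s0) gt_eqF// sqrtr_gt0 pmulrn_lgt0// pi_gt0.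
rewrite -expRD; congr (_ * expR _).
rewrite subr0 -[_^-1 *+ 2]mulr_natr.
by field; rewrite gt_eqF.
Qed.

Lemma lebesgue_measure_shift t (A : set R) : measurable A ->
  pushforward leb (fun x : measurableTypeR R => x + t : measurableTypeR R) A =
  leb A.
Proof.
move=> mA.
apply/esym/lebesgue_measure_unique => //=. 
  by apply: measurable_funD.
move=> _ _ [[a b]] _ <-.
rewrite /pushforward.
rewrite (_ : _ @^-1` _ = [set` `](a - t), (b - t)]]); last first.
  by apply/seteqP; split => x /=; rewrite !in_itv/= ltrBlDr lerBrDr.
rewrite /= !lebesgue_measure_itv/= !lte_fin ltrD2r.
by rewrite -!EFinB (_ : b - t - (a - t) = b - a)//; ring.
Qed.

Lemma ge0_integral_normal_shift t (f : R -> \bar R) :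
  measurable_fun setT f -> (forall x, 0 <= f x)%E ->
  (\int[leb]_x (f (x + t)%R * (normal_pdf 0 1 x)%:E) =
   \int[leb]_x (f x * (normal_pdf t 1 x)%:E))%E.
Proof.
move=> mf f0.
have mshift : measurable_fun setT
    (fun x : measurableTypeR R => x + t : measurableTypeR R).
  by apply: measurable_funD.
pose h x := (f x * (normal_pdf t 1 x)%:E)%E.
have mh : measurable_fun setT h.
  apply: emeasurable_funM => //; apply/measurable_EFinP.
  exact: measurable_normal_pdf.
have h0 x : (0 <= h x)%E by rewrite mule_ge0// lee_fin normal_pdf_ge0.
transitivity (\int[pushforward leb
    (fun x : measurableTypeR R => (x + t)%R : measurableTypeR R)]_x h x)%E.
  rewrite (ge0_integral_pushforward mshift _ measurableT mh); last first.
    by move=> x _; exact: h0.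
  rewrite preimage_setT; apply: eq_integral => x _ /=.
  by rewrite /h !normal_pdf1E addrK subr0.
by apply: eq_measure_integral => A mA _; exact: lebesgue_measure_shift.
Qed.

Lemma ge0_integral_normalRV d (T : measurableType d) (P : probability T R)
    (X : {RV P >-> R}) (f : R -> \bar R) :
  (forall A : set R, measurable A -> distribution P X A = normal_prob 0 1 A) ->
  measurable_fun setT f -> (forall x, 0 <= f x)%E ->
  (\int[P]_w f (X w) = \int[leb]_x (f x * (normal_pdf 0 1 x)%:E))%E.
Proof.
move=> XN mf f0.
under eq_integral do rewrite -[f _]mule1.
apply: (@ge0_integral_weighted_eq _ _ _ _ _ _ _ P leb X (fun=> 1) id
  (normal_pdf 0 1)) => //.
- exact: measurable_normal_pdf.
- by move=> x; exact: normal_pdf_ge0.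
- move=> A mA; rewrite preimage_id integral_cst ?mul1e; last first.
    by rewrite -[_ @^-1` _]setTI; exact: measurable_funP.
  exact: XN.
Qed.

End normal.

(** * Independence and change of measure *)

Section independent.
Context d (T : measurableType d) (R : realType) (P : probability T R).
Variable xi : nat -> {RV P >-> R}.
Hypothesis xi_indep : mutually_independent xi.

Lemma integral_indic_product (J : seq nat) (B : nat -> set R) : uniq J ->
  (forall k, measurable (B k)) ->
  (\int[P]_w (\prod_(k <- J) \1_(B k) (xi k w))%:E =
   (\prod_(k <- J) fine (P (xi k @^-1` B k)))%:E)%E.
Proof.
move=> uJ mB.
have mxB k : measurable (xi k @^-1` B k).
  by rewrite -[_ @^-1` _]setTI; exact: measurable_funP.
have -> : (\prod_(k <- J) fine (P (xi k @^-1` B k)))%:E =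
    (\prod_(k <- J) P (xi k @^-1` B k))%E.
  rewrite (big_morph EFin (@EFinM R) (erefl _)); apply: eq_bigr => k _.
  by rewrite fineK// fin_num_measure.
rewrite -xi_indep//.
set A := \bigcap_(k in _) _.
have mA : measurable A.
  by apply: fin_bigcap_measurable => // k _; exact: mxB.
rewrite -[in RHS](setIT A) -integral_indic//; apply: eq_integral => w _.
congr EFin; rewrite indicE; case: (boolP (w \in A)) => wA.
  rewrite big1_seq// => k /= kJ; rewrite indicE mem_set//.
  by move: wA; rewrite inE => /(_ k kJ).
have [k kJ wk] : exists2 k, k \in J & ~ B k (xi k w).
  apply: contrapT => H; move: wA; rewrite notin_setE; apply => k kJ.
  by apply: contrapT => wk; apply: H; exists k.
by rewrite (big_rem k)//= indicE memNset// mul0r.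
Qed.

(* The functions of the [xi k] are introduced one at a time: for fixed indicator
   and function factors, [xi k] has under the density given by their product the
   same law, up to a constant, as under [P]. *)
Lemma integral_mixed_product (K : seq nat) (f : nat -> R -> R) (e : nat -> R) :
  (forall k, measurable_fun setT (f k)) -> (forall k x, 0 <= f k x) ->
  (forall k, \int[P]_w (f k (xi k w))%:E = (e k)%:E)%E ->
  forall (J : seq nat) (B : nat -> set R), uniq (J ++ K) ->
  (forall k, measurable (B k)) ->
  (\int[P]_w ((\prod_(k <- J) \1_(B k) (xi k w)) *
              \prod_(k <- K) f k (xi k w))%:E =
   ((\prod_(k <- J) fine (P (xi k @^-1` B k))) * \prod_(k <- K) e k)%:E)%E.
Proof.
move=> mf f0 fe; elim: K => [|k K IH] J B uJK mB.
  under eq_integral do rewrite big_nil mulr1.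
  by rewrite big_nil mulr1 integral_indic_product//; rewrite cats0 in uJK.
have [kJ kK uJK'] : [/\ k \notin J, k \notin K & uniq (J ++ K)].
  move: uJK; rewrite !cat_uniq/= negb_or -!andbA.
  by move=> /and5P[-> -> -> -> ->].
pose c := (\prod_(i <- J) fine (P (xi i @^-1` B i))) * \prod_(i <- K) e i.
have e0 i : 0 <= e i.
  by rewrite -lee_fin -fe integral_ge0// => w _; rewrite lee_fin.
have c0 : 0 <= c.
  apply: mulr_ge0; apply: prodr_ge0 => i _ //.
  by rewrite fine_ge0.
pose F w := (\prod_(i <- J) \1_(B i) (xi i w)) * \prod_(i <- K) f i (xi i w).
have F0 w : 0 <= F w by apply: mulr_ge0; apply: prodr_ge0.
have mF : measurable_fun setT F.
  apply: measurable_funM; apply: measurable_prod => i _.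
    apply: measurableT_comp; first exact: measurable_indic.
    exact: measurable_funP.
  by apply: measurableT_comp; [exact: mf|exact: measurable_funP].
transitivity (\int[P]_w ((f k (xi k w))%:E * (F w)%:E))%E.
  apply: eq_integral => w _; rewrite -EFinM big_cons /F; congr EFin; ring.
rewrite (@ge0_integral_weighted_eq _ _ _ _ _ _ _ P P (xi k) F (xi k) (fun=> c)
  _ mF F0 _ _ (fun=> c0) (fun x => (f k x)%:E)) => //.
- rewrite ge0_integralZr//; last 2 first.
  + apply/measurable_EFinP; apply: measurableT_comp; first exact: mf.
    exact: measurable_funP.
  + by move=> w _; rewrite lee_fin.
  by rewrite fe -EFinM /c big_cons; congr EFin; ring.
- move=> A mA.
  (* The induction hypothesis is applied with [k] moved to the indicator side, carrying the set [A];
     as [k] is not in [J], the other factors are unchanged. *)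
  pose B' i := if i == k then A else B i.
  have mB' i : measurable (B' i) by rewrite /B'; case: ifP.
  have uk : uniq ((k :: J) ++ K).
    by rewrite /= mem_cat negb_or kJ kK.
  have := IH (k :: J) B' uk mB'.
  have B'J (g : nat -> set R -> R) :
      \prod_(i <- J) g i (B' i) = \prod_(i <- J) g i (B i).
    rewrite !big_seq; apply: eq_bigr => i iJ; rewrite /B'.
    by case: eqP iJ kJ => // ->->.
  rewrite big_cons (B'J (fun i A => fine (P (xi i @^-1` A)))) {2}/B' eqxx.
  rewrite -[in RHS]mulrA -/c => h.
  have mxA : measurable (xi k @^-1` A).
    by rewrite -[_ @^-1` _]setTI; exact: measurable_funP.
  rewrite integral_cst//.
  transitivity ((fine (P (xi k @^-1` A)) * c)%:E); last first.
    by rewrite EFinM fineK ?fin_num_measure// muleC.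
  rewrite -h.
  rewrite integral_mkcond; apply: eq_integral => w _.
  rewrite patchE big_cons (B'J (fun i A => \1_A (xi i w))) /B' eqxx.
  rewrite -[in RHS]mulrA -/(F w) indicE.
  case: ifPn => wA.
  - by rewrite mem_set ?mul1r//; rewrite inE in wA.
  - by rewrite memNset ?mul0r//; rewrite notin_setE in wA.
- by apply/measurable_EFinP.
- by move=> x; rewrite lee_fin.
Qed.

Lemma integral_product (K : seq nat) (f : nat -> R -> R) (e : nat -> R) :
  uniq K ->
  (forall k, measurable_fun setT (f k)) -> (forall k x, 0 <= f k x) ->
  (forall k, \int[P]_w (f k (xi k w))%:E = (e k)%:E)%E ->
  (\int[P]_w (\prod_(k <- K) f k (xi k w))%:E = (\prod_(k <- K) e k)%:E)%E.
Proof.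
move=> uK mf f0 fe.
have := @integral_mixed_product K f e mf f0 fe [::] (fun=> setT) uK.
rewrite big_nil mul1r => <-; last by move=> k; exact: measurableT.
by apply: eq_integral => w _; rewrite big_nil mul1r.
Qed.

End independent.

(** * The product sigma-algebra of the observation space *)

Section obs_space.
Context {R : realType}.

Lemma measurable_coordinate k : measurable_fun setT (fun y : obs_space R => y k).
Proof.
move=> _ B mB; rewrite setTI; apply: sub_sigma_algebra.
by exists k, B.
Qed.

Definition rectangle (B : nat -> set R) : set (obs_space R) :=
  [set y | forall k, B k (y k)].

(** Cylinders over a single coordinate are not closed under intersection; rectangles with finitely
    many constrained coordinates form a pi-system with the same sigma-algebra. *)
Definition rectangles : set (set (obs_space R)) :=
  [set C | exists n (B : nat -> set R), [/\ forall k, measurable (B k),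
    forall k, (n <= k)%N -> B k = setT & C = rectangle B]].

Lemma rectangles_setI : setI_closed rectangles.
Proof.
move=> _ _ [n [B [mB Bn ->]]] [n' [B' [mB' Bn' ->]]].
exists (maxn n n'), (fun k => B k `&` B' k); split.
- by move=> k; exact: measurableI.
- by move=> k; rewrite geq_max => /andP[nk n'k]; rewrite Bn// Bn'// setTI.
- by apply/seteqP; split=> [y [yB yB'] k|y yBB']; [split|split=> k; case: (yBB' k)].
Qed.

Lemma rectangles_setT : rectangles setT.
Proof.
by exists 0%N, (fun=> setT); split=> //; apply/seteqP; split.
Qed.

Lemma measurable_rectangle B : (forall k, measurable (B k)) ->
  measurable (rectangle B).
Proof.
move=> mB.
rewrite (_ : rectangle B = \bigcap_k ((fun y : obs_space R => y k) @^-1` B k)).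
  apply: bigcapT_measurable => k; rewrite -[_ @^-1` _]setTI.
  exact: measurable_coordinate.
by apply/seteqP; split=> [y yB k _|y yB k]; [exact: yB|exact: yB].
Qed.

Lemma obs_space_measurableE :
  @measurable _ (obs_space R) = <<s rectangles >>.
Proof.
apply/seteqP; split.
- apply: smallest_sub; first exact: smallest_sigma_algebra.
  move=> _ [k [B [mB ->]]]; apply: sub_sigma_algebra.
  exists k.+1, (fun i => if i == k then B else setT); split.
  + by move=> i; case: ifP.
  + by move=> i ki; rewrite gtn_eqF.
  + apply/seteqP; split=> [y yB i|y /(_ k)]; last by rewrite eqxx.
    by case: eqP => // ->.
- apply: smallest_sub; first exact: sigma_algebra_measurable.
  by move=> _ [n [B [mB _ ->]]]; exact: measurable_rectangle.
Qed.

Lemma indic_rectangle (B : nat -> set R) n (y : obs_space R) :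
  (forall k, (n <= k)%N -> B k = setT) ->
  \1_(rectangle B) y = \prod_(0 <= k < n) \1_(B k) (y k) :> R.
Proof.
move=> Bn; rewrite indicE; case: (boolP (y \in rectangle B)) => yB.
  rewrite big1// => k _; rewrite indicE mem_set//.
  by move: yB; rewrite inE; exact.
have [k kn yk] : exists2 k, (k < n)%N & ~ B k (y k).
  apply: contrapT => H; move: yB; rewrite notin_setE; apply => k.
  apply: contrapT => yk; have [kn|nk] := ltnP k n; first by apply: H; exists k.
  by apply: yk; rewrite Bn.
rewrite (big_rem k)/= ?mem_index_iota//.
by rewrite indicE memNset// mul0r.
Qed.

End obs_space.

(** * Shifts of the Gaussian sequence *)

Section gaussian_shift.
Context d (T : measurableType d) (R : realType) (P : probability T R).
Variable xi : nat -> {RV P >-> R}.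
Hypothesis xi_iid : iid_standard_normal xi.

Lemma measurable_observation (eps : R) (eta : nat -> R) :
  measurable_fun setT (observation xi eps eta).
Proof.
apply: (@measurability _ _ _ (obs_space R) _ _ (@cylinders R)) => //.
move=> _ [_ [k [B [mB ->]]] <-].
rewrite (_ : _ @^-1` _ = (fun w => eta k + eps * xi k w) @^-1` B)//.
suff : measurable_fun setT (fun w => eta k + eps * xi k w) by exact.
by apply: measurable_funD => //; apply: measurable_funM.
Qed.

(** Translation invariance of Lebesgue measure moves the shift onto the normal density, and
    [normal_pdf_tilt] writes the shifted density as an exponential times the standard one. *)
Lemma ge0_integral_tilt k (t : R) (f : R -> \bar R) :
  measurable_fun setT f -> (forall x, 0 <= f x)%E ->
  (\int[P]_w f (xi k w + t)%R =
   \int[P]_w (f (xi k w) * (expR (t * xi k w - t ^+ 2 / 2))%:E))%E.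
Proof.
move=> mf f0; have [xiN _] := xi_iid.
have mft : measurable_fun setT (fun x : R => f (x + t)%R).
  by apply: measurableT_comp => //; exact: measurable_funD.
have mfe : measurable_fun setT
    (fun x : R => f x * (expR (t * x - t ^+ 2 / 2))%:E)%E.
  apply: emeasurable_funM => //; apply/measurable_EFinP.
  apply: measurableT_comp => //; apply: measurable_funB => //.
rewrite (ge0_integral_normalRV (xiN k) mft)//.
rewrite (ge0_integral_normalRV (xiN k) mfe); last first.
  by move=> x; rewrite mule_ge0// lee_fin expR_ge0.
rewrite (ge0_integral_normal_shift t mf f0); apply: eq_integral => x _.
by rewrite -muleA -EFinM -normal_pdf_tilt [in RHS]mulrC.
Qed.

(** The likelihood ratio of the mean [eps * theta] against the mean 0 when [theta] vanishes from [n]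
    on. *)
Definition tilt (theta : nat -> R) n (w : T) : R :=
  \prod_(0 <= k < n) expR (theta k * xi k w - theta k ^+ 2 / 2).

Lemma tilt_ge0 theta n w : 0 <= tilt theta n w.
Proof. by apply: prodr_ge0 => k _; exact: expR_ge0. Qed.

Lemma measurable_tilt theta n : measurable_fun setT (tilt theta n).
Proof.
apply: measurable_prod => k _; apply: measurableT_comp => //.
by apply: measurable_funB => //; apply: measurable_funM.
Qed.

Lemma tilt_widen theta n n' w : (n <= n')%N ->
  (forall k, (n <= k)%N -> theta k = 0) -> tilt theta n' w = tilt theta n w.
Proof.
move=> nn' t0; rewrite /tilt (big_cat_nat (n := n))//= [X in _ * X]big_nat.
rewrite [X in _ * X]big1 ?mulr1// => k /andP[nk _].
by rewrite t0// mul0r expr0n/= mul0r subr0 expR0.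
Qed.

(** By uniqueness on a pi-system it suffices to compare the two laws on rectangles. There
    independence factorizes both sides, and [ge0_integral_tilt] matches the factors. *)
Lemma change_of_measure (eps : R) (theta : nat -> R) n
    (h : obs_space R -> \bar R) :
  (forall k, (n <= k)%N -> theta k = 0) ->
  measurable_fun setT h -> (forall y, 0 <= h y)%E ->
  (\int[P]_w h (observation xi eps (fun k => eps * theta k)%R w) =
   \int[P]_w (h (observation xi eps (fun=> 0%R) w) * (tilt theta n w)%:E))%E.
Proof.
move=> t0 mh h0.
under eq_integral do rewrite -[h _]mule1.
apply: (@ge0_integral_weighted_eq_generated _ _ _ _ _ _ _ P P
  (observation xi eps (fun k => eps * theta k)) (fun=> 1)
  (observation xi eps (fun=> 0)) (tilt theta n)
  _ _ _ _ _ _ rectangles h) => //.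
- exact: measurable_observation.
- exact: measurable_observation.
- exact: measurable_tilt.
- exact: tilt_ge0.
- exact: obs_space_measurableE.
- exact: rectangles_setI.
- exact: rectangles_setT.
- by rewrite integral_cst// mul1e ltey_eq fin_num_measure.
move=> _ [n' [B [mB Bn' ->]]].
(* Beyond [N] neither the rectangle constrains a coordinate nor does [theta] shift one. *)
pose N := maxn n n'.
have BN k : (N <= k)%N -> B k = setT.
  by rewrite geq_max => /andP[_ ?]; exact: Bn'.
pose f1 k x : R := \1_(B k) (eps * theta k + eps * x).
pose f2 k x : R := \1_(B k) (0 + eps * x) *
  expR (theta k * x - theta k ^+ 2 / 2).
have mind k (c : R) : measurable_fun setT (fun x : R => \1_(B k) (c + eps * x) : R).
  apply: measurableT_comp; first exact: measurable_indic.
  by apply: measurable_funD => //; exact: measurable_funM.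
have mf1 k : measurable_fun setT (f1 k) by exact: mind.
have mf2 k : measurable_fun setT (f2 k).
  apply: measurable_funM; first exact: mind.
  apply: measurableT_comp => //; apply: measurable_funB => //.
have f10 k x : 0 <= f1 k x by rewrite /f1.
have f20 k x : 0 <= f2 k x by rewrite mulr_ge0// expR_ge0.
pose e k := fine (\int[P]_w (f1 k (xi k w))%:E)%E.
have e1 k : (\int[P]_w (f1 k (xi k w))%:E = (e k)%:E)%E.
  rewrite fineK// ge0_fin_numE; last by apply: integral_ge0 => w _; rewrite lee_fin.
  apply: (@le_lt_trans _ _ (\int[P]_w 1%:E)%E).
    apply: ge0_le_integral => //.
    - by move=> w _; rewrite lee_fin.
    - by apply/measurable_EFinP; apply: measurableT_comp; [exact: mf1|].
    - by move=> w _; rewrite lee_fin /f1 indicE lern1 leq_b1.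
  by rewrite integral_cst// mul1e ltey_eq fin_num_measure.
have e2 k : (\int[P]_w (f2 k (xi k w))%:E = (e k)%:E)%E.
  rewrite -e1; symmetry.
  have := @ge0_integral_tilt k (theta k)
    (fun x => (\1_(B k) (0 + eps * x) : R)%:E).
  rewrite (_ : (fun w => _) = (fun w => (f1 k (xi k w))%:E)); last first.
    by apply/funext => w; rewrite /f1 add0r mulrDr addrC.
  move=> ->.
  - by apply: eq_integral => w _; rewrite -EFinM.
  - by apply/measurable_EFinP; exact: mind.
  - by move=> x; rewrite lee_fin.
have [_ indep] := xi_iid.
transitivity (\prod_(0 <= k < N) e k)%:E.
  rewrite -(integral_product indep (iota_uniq _ _) mf1 f10 e1).
  rewrite integral_mkcond; apply: eq_integral => w _.
  rewrite -(@indic_rectangle _ B N (observation xi eps (fun k => eps * theta k) w))//.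
  by rewrite patchE indicE; case: ifPn => wA;
    [rewrite mem_set//; rewrite inE in wA|
     rewrite memNset//; rewrite notin_setE in wA].
rewrite -(integral_product indep (iota_uniq _ _) mf2 f20 e2).
rewrite [RHS]integral_mkcond; apply: eq_integral => w _.
rewrite big_split/=.
rewrite -(@indic_rectangle _ B N (observation xi eps (fun=> 0) w))//.
rewrite -/(tilt theta N w) (tilt_widen _ (leq_maxl _ _) t0).
by rewrite patchE indicE; case: ifPn => wA;
  [rewrite mem_set ?mul1r//; rewrite inE in wA|
   rewrite memNset ?mul0r//; rewrite notin_setE in wA].
Qed.

End gaussian_shift.

(** * Bounds on the minimax error *)

Section gamma_bounds.
Context d (T : measurableType d) (R : realType) (P : probability T R).
Variable xi : nat -> {RV P >-> R}.
Hypothesis xi_iid : iid_standard_normal xi.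

Lemma integral_probability_cst (c : R) : (\int[P]_w c%:E = c%:E)%E.
Proof.
by rewrite integral_cst// -[RHS]mule1; congr (_ * _)%E; exact: probability_setT.
Qed.

Lemma integral_gauss k (g t : R) : 0 <= g ->
  (\int[P]_w (expR (- (g * (t + xi k w) ^+ 2) / 2))%:E =
   ((Num.sqrt (1 + g))^-1 * expR (- (g * t ^+ 2) / (2 * (1 + g))))%:E)%E.
Proof.
move=> g0; have [xiN _] := xi_iid.
have mf : measurable_fun setT
    (fun x : R => (expR (- (g * (t + x) ^+ 2) / 2))%:E).
  apply/measurable_EFinP; apply: measurableT_comp => //.
  apply: measurable_funM => //; apply: measurableT_comp => //.
  apply: measurable_funM => //; apply: measurable_funX.
  exact: measurable_funD.
rewrite (ge0_integral_normalRV (xiN k) mf); last first.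
  by move=> x; rewrite lee_fin expR_ge0.
under eq_integral do rewrite -EFinM mulrC normal_pdf_gauss// EFinM.
rewrite ge0_integralZl_EFin//.
- by rewrite integral_normal_pdf mule1.
- by move=> x _; rewrite lee_fin normal_pdf_ge0.
- by apply/measurable_EFinP; exact: measurable_normal_pdf.
Qed.

Lemma integral_exp_tilt k (t : R) :
  (\int[P]_w (expR (t * xi k w - t ^+ 2 / 2))%:E = 1)%E.
Proof.
have := ge0_integral_tilt xi_iid k t (measurable_cst 1%E) (fun=> lee01).
rewrite integral_probability_cst => ->.
by apply: eq_integral => w _; rewrite mul1e.
Qed.

Let mtilt (t : R) : measurable_fun setT (fun x : R => expR (t * x - t ^+ 2 / 2)).
Proof. by apply: measurableT_comp => //; apply: measurable_funB. Qed.

Lemma integral_tilt theta n : (\int[P]_w (tilt xi theta n w)%:E = 1)%E.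
Proof.
have [_ indep] := xi_iid.
rewrite (integral_product indep (iota_uniq _ _)
  (f := fun k x => expR (theta k * x - theta k ^+ 2 / 2)) (e := fun=> 1)).
- by rewrite big1.
- by move=> k; exact: mtilt.
- by move=> k x; exact: expR_ge0.
- by move=> k; exact: integral_exp_tilt.
Qed.

Lemma integral_sqr_tilt theta n :
  (\int[P]_w (tilt xi theta n w ^+ 2)%:E =
   (expR (\sum_(0 <= k < n) theta k ^+ 2))%:E)%E.
Proof.
have [_ indep] := xi_iid.
under eq_integral do rewrite /tilt -prodrXl.
rewrite (integral_product indep (iota_uniq _ _)
  (f := fun k x => expR (theta k * x - theta k ^+ 2 / 2) ^+ 2)
  (e := fun k => expR (theta k ^+ 2))).
- by rewrite expR_sum.
- by move=> k; apply: measurable_funX; exact: mtilt.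
- by move=> k x; exact: sqr_ge0.
(* Squaring the factor with parameter theta gives exp (theta^2) times the factor with parameter 2
   theta, whose mean is 1. *)
- move=> k; transitivity (\int[P]_w ((expR (theta k ^+ 2))%:E *
    (expR ((2 * theta k) * xi k w - (2 * theta k) ^+ 2 / 2))%:E))%E.
    apply: eq_integral => w _; rewrite -EFinM -expRD expr2 -expRD.
    by congr (expR _)%:E; field.
  rewrite ge0_integralZl_EFin ?expR_ge0//.
  + by rewrite integral_exp_tilt mule1.
  + apply/measurable_EFinP.
    by apply: (measurableT_comp (mtilt (2 * theta k))).
Qed.

Lemma EobsE (eps : R) eta (f : obs_space R -> R) :
  Eobs xi eps eta f = (\int[P]_w (f (observation xi eps eta w))%:E)%E.
Proof. by rewrite /Eobs unlock. Qed.

(* The total error of any test of 0 against [eta] is at least [E min(1, L)];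
   quadratic minorants of [min(1, L)] are used because the first two moments of
   the likelihood ratio [L] are explicit. *)
Lemma gamma_eps_ge (a sigma eta : nat -> R) (eps r q0 q1 q2 : R) n :
  0 < eps -> Theta2r a sigma r eta -> (forall k, (n <= k)%N -> eta k = 0) ->
  0 <= q1 -> 0 <= q2 ->
  (forall L, 0 <= L -> q0 + q1 * L - q2 * L ^+ 2 <= Num.min 1 L) ->
  ((q0 + q1 - q2 * expR ((\sum_(0 <= k < n) eta k ^+ 2) / eps ^+ 2))%:E <=
    gamma_eps xi a sigma eps r)%E.
Proof.
move=> eps0 etain eta0 q10 q20 qmin.
apply: le_ereal_inf_tmp => _ [psi [mpsi psi01] <-].
apply: (@le_trans _ _ (Eobs xi eps (fun=> 0%R) psi +
    Eobs xi eps eta (fun y => 1 - psi y)%R)%E); last first.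
  by rewrite leeD2l//; apply: ereal_sup_ubound; exists eta.
pose theta k := eta k / eps.
have theta0 k : (n <= k)%N -> theta k = 0 by move=> nk; rewrite /theta eta0// mul0r.
have etaE : eta = (fun k => eps * theta k).
  by apply/funext => k; rewrite /theta mulrC divfK// gt_eqF.
pose L := tilt xi theta n.
have L0 w : 0 <= L w by exact: tilt_ge0.
have mL : measurable_fun setT L by exact: measurable_tilt.
pose p w := psi (observation xi eps (fun=> 0) w).
have p0 w : 0 <= p w by have /andP[] := psi01 (observation xi eps (fun=> 0) w).
have p1 w : 0 <= 1 - p w.
  by rewrite subr_ge0; have /andP[] := psi01 (observation xi eps (fun=> 0) w).
have mp : measurable_fun setT p.
  by apply: measurableT_comp => //; exact: measurable_observation.
have -> : Eobs xi eps eta (fun y => 1 - psi y) =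
    (\int[P]_w ((1 - p w) * L w)%:E)%E.
  rewrite EobsE etaE (change_of_measure xi_iid (n := n) eps
    (h := fun y => (1 - psi y)%:E) theta0).
  - by apply: eq_integral => w _; rewrite -EFinM.
  - by apply/measurable_EFinP; exact: measurable_funB.
  - by move=> y; rewrite lee_fin subr_ge0; have /andP[] := psi01 y.
rewrite EobsE -/(p _).
set u := (\sum_(0 <= k < n) eta k ^+ 2) / eps ^+ 2.
have uE : \sum_(0 <= k < n) theta k ^+ 2 = u.
  by rewrite /u mulr_suml; apply: eq_bigr => k _; rewrite /theta expr_div_n.
have mpL : measurable_fun setT (fun w => (1 - p w) * L w).
  by apply: measurable_funM => //; exact: measurable_funB.
rewrite -[leRHS]ge0_integralD//; last 4 first.
- by move=> w _; rewrite lee_fin p0.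
- exact/measurable_EFinP.
- by move=> w _; rewrite lee_fin mulr_ge0.
- exact/measurable_EFinP.
(* [q0] may be negative; its positive and negative parts are put on opposite sides, so that only
   nonnegative functions are integrated. *)
pose m0 := Num.max 0 (- q0); pose m1 := Num.max 0 q0.
have m00 : 0 <= m0 by rewrite le_max lexx.
have m10 : 0 <= m1 by rewrite le_max lexx.
have q0E : q0 = m1 - m0.
  rewrite /m0 /m1; case: (leP 0 q0) => h.
    by rewrite max_l ?oppr_le0// subr0.
  by rewrite max_r ?oppr_ge0 ?(ltW h)// sub0r opprK.
suff H : ((m1 + q1)%:E <= \int[P]_w (p w + (1 - p w) * L w)%:E +
    (m0 + q2 * expR u)%:E)%E.
  rewrite (_ : (q0 + q1 - _)%:E = ((m1 + q1)%:E - (m0 + q2 * expR u)%:E)%E).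
    by rewrite leeBlDr.
  by rewrite -EFinB q0E; congr EFin; ring.
have mq1 : measurable_fun setT (fun w => m1 + q1 * L w).
  by apply: measurable_funD => //; exact: measurable_funM.
have mq2 : measurable_fun setT (fun w => m0 + q2 * L w ^+ 2).
  apply: measurable_funD => //; apply: measurable_funM => //.
  exact: measurable_funX.
have mr : measurable_fun setT (fun w => p w + (1 - p w) * L w).
  exact: measurable_funD.
have r0 w : 0 <= p w + (1 - p w) * L w.
  by rewrite addr_ge0// mulr_ge0.
have -> : ((m1 + q1)%:E = \int[P]_w (m1 + q1 * L w)%:E)%E.
  under eq_integral do rewrite EFinD EFinM.
  rewrite ge0_integralD//; last 2 first.
  - by move=> w _; rewrite mule_ge0 ?lee_fin.
  - by apply: emeasurable_funM => //; exact/measurable_EFinP.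
  rewrite integral_probability_cst.
  rewrite ge0_integralZl_EFin//; last 2 first.
  - by move=> w _; rewrite lee_fin.
  - exact/measurable_EFinP.
  by rewrite integral_tilt mule1.
have -> : ((m0 + q2 * expR u)%:E = \int[P]_w (m0 + q2 * L w ^+ 2)%:E)%E.
  under eq_integral do rewrite EFinD EFinM.
  rewrite ge0_integralD//; last 2 first.
  - by move=> w _; rewrite mule_ge0 ?lee_fin// sqr_ge0.
  - apply: emeasurable_funM => //; apply/measurable_EFinP.
    exact: measurable_funX.
  rewrite integral_probability_cst.
  rewrite ge0_integralZl_EFin//; last 2 first.
  - by move=> w _; rewrite lee_fin sqr_ge0.
  - by apply/measurable_EFinP; exact: measurable_funX.
  by rewrite integral_sqr_tilt uE.
rewrite -ge0_integralD//; last 4 first.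
- by move=> w _; rewrite lee_fin.
- exact/measurable_EFinP.
- by move=> w _; rewrite lee_fin addr_ge0// mulr_ge0// sqr_ge0.
- exact/measurable_EFinP.
apply: ge0_le_integral => //.
- by move=> w _; rewrite lee_fin addr_ge0// mulr_ge0.
- exact/measurable_EFinP.
- by apply/measurable_EFinP; exact: measurable_funD.
- move=> w _; rewrite -EFinD lee_fin.
  have := qmin _ (L0 w).
  (* The right side is a convex combination of 1 and L with weights p and 1 - p. *)
  have : Num.min 1 (L w) <= p w + (1 - p w) * L w.
    have h1 : Num.min 1 (L w) <= 1 by rewrite ge_min lexx.
    have h2 : Num.min 1 (L w) <= L w by rewrite ge_min lexx orbT.
    have := ler_wpM2l (p0 w) h1; have := ler_wpM2l (p1 w) h2; lra.
  rewrite q0E; lra.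
Qed.

(** The test is 1 - phi with phi = exp (- t/2 sum g_k (y_k/eps)^2). The mean of phi is A at 0 and at
    most A B on the alternative, so the total error is at most 1 - A (1 - B), where A >= exp (- t S
    / 2). *)
Lemma gamma_eps_le (a sigma g : nat -> R) (eps r S u t : R) n :
  0 < eps -> 0 < t -> (forall k, 0 <= g k) -> 0 <= u ->
  \sum_(0 <= k < n) g k <= S ->
  (forall eta, Theta2r a sigma r eta ->
     eps ^+ 2 * u <= \sum_(0 <= k < n) g k * eta k ^+ 2) ->
  (gamma_eps xi a sigma eps r <=
    (1 - expR (- (t * S / 2)) * (1 - expR (- (t * u / (2 * (1 + t * S))))))%:E)%E.
Proof.
move=> eps0 t0 g0 u0 gS gu.
have [_ indep] := xi_iid.
pose tg k := t * g k.
have tg0 k : 0 <= tg k by rewrite mulr_ge0// ltW.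
pose phi (y : obs_space R) : R :=
  \prod_(0 <= k < n) expR (- (tg k * (y k / eps) ^+ 2) / 2).
have phi0 y : 0 <= phi y by apply: prodr_ge0 => k _; exact: expR_ge0.
have phi1 y : phi y <= 1.
  rewrite /phi -expR_sum -[leRHS]expR0 ler_expR.
  apply: sumr_le0 => k _; rewrite mulNr oppr_le0 divr_ge0// mulr_ge0//.
  exact: sqr_ge0.
have mphi : measurable_fun setT phi.
  apply: measurable_prod => k _; apply: measurableT_comp => //.
  apply: measurable_funM => //; apply: measurableT_comp => //.
  apply: measurable_funM => //; apply: measurable_funX.
  by apply: measurable_funM => //; exact: measurable_coordinate.
pose s k : R := (Num.sqrt (1 + tg k))^-1.
have s0 k : 0 <= s k by rewrite invr_ge0 sqrtr_ge0.
pose A := \prod_(0 <= k < n) s k.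
have phiE eta : (\int[P]_w (phi (observation xi eps eta w))%:E =
    (A * expR (- \sum_(0 <= k < n)
      tg k * (eta k / eps) ^+ 2 / (2 * (1 + tg k))))%:E)%E.
  rewrite /A -sumrN expR_sum -big_split/=.
  rewrite -(integral_product indep (iota_uniq _ _)
    (f := fun k x => expR (- (tg k * (eta k / eps + x) ^+ 2) / 2))).
  - apply: eq_integral => w _; congr EFin; apply: eq_bigr => k _.
    have -> // : observation xi eps eta w k / eps = eta k / eps + xi k w.
    by rewrite /observation mulrDl (mulrC eps) mulfK// gt_eqF.
  - move=> k; apply: measurableT_comp => //.
    apply: measurable_funM => //; apply: measurableT_comp => //.
    apply: measurable_funM => //; apply: measurable_funX.
    exact: measurable_funD.
  - by move=> k x; exact: expR_ge0.
  - by move=> k; rewrite integral_gauss// mulNr.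
have A0 : 0 <= A by exact: prodr_ge0.
have S0 : 0 <= S by apply: le_trans gS; exact: sumr_ge0.
(* Factor by factor, sqrt (1 + x) <= exp (x / 2), from 1 + x <= exp x. *)
have AS : expR (- (t * S / 2)) <= A.
  apply: (@le_trans _ _ (\prod_(0 <= k < n) expR (- (tg k / 2)))).
    rewrite -expR_sum ler_expR sumrN lerN2 -mulr_suml -mulr_sumr.
    by rewrite ler_wpM2r// ler_wpM2l// ltW.
  apply: ler_prod => k _; rewrite expR_ge0/= expRN lef_pV2 ?posrE ?expR_gt0//.
    rewrite -(@ler_pXn2r _ 2) ?nnegrE ?sqrtr_ge0 ?expR_ge0//.
    rewrite sqr_sqrtr ?addr_ge0// expr2 -expRD -splitr.
    exact: expR_ge1Dx.
  by rewrite sqrtr_gt0 ltr_pwDl.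
pose B := expR (- (t * u / (2 * (1 + t * S)))).
have test : is_test (fun y => 1 - phi y).
  split; first exact: measurable_funB.
  by move=> y; rewrite subr_ge0 phi1 gerBl phi0.
have E0 : Eobs xi eps (fun=> 0) (fun y => 1 - phi y) = (1 - A)%:E.
  have h1 := phiE (fun=> 0).
  rewrite big1 in h1; last by move=> k _; rewrite mul0r expr0n mulr0 mul0r.
  rewrite oppr0 expR0 mulr1 in h1.
  have mo : measurable_fun setT (fun w => phi (observation xi eps (fun=> 0) w)).
    by apply: measurableT_comp => //; exact: measurable_observation.
  have h2 : (\int[P]_w (1 - phi (observation xi eps (fun=> 0) w))%:E +
      \int[P]_w (phi (observation xi eps (fun=> 0) w))%:E = 1)%E.
    rewrite -ge0_integralD//; last 4 first.
    - by move=> w _; rewrite lee_fin subr_ge0.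
    - by apply/measurable_EFinP; exact: measurable_funB.
    - by move=> w _; rewrite lee_fin.
    - exact/measurable_EFinP.
    under eq_integral do rewrite -EFinD subrK.
    exact: integral_probability_cst.
  by rewrite EobsE EFinB -h1 -h2 addeK// h1.
apply: (@le_trans _ _ (1 - A * (1 - B))%:E); last first.
  rewrite lee_fin lerD2l lerN2 ler_wpM2r//.
  rewrite subr_ge0 -[leRHS]expR0 ler_expR oppr_le0.
  by rewrite divr_ge0 ?mulr_ge0 ?addr_ge0 ?mulr_ge0// ltW.
have tS0 : 0 < 2 * (1 + t * S) by rewrite mulr_gt0// ltr_pwDl// mulr_ge0// ltW.
have power eta : Theta2r a sigma r eta ->
    (Eobs xi eps eta (fun y => 1 - (1 - phi y))%R <= (A * B)%:E)%E.
  move=> /gu etain; rewrite EobsE.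
  under eq_integral do rewrite opprB addrC subrK.
  rewrite phiE lee_fin ler_wpM2l// ler_expR lerN2.
  apply: (@le_trans _ _ (\sum_(0 <= k < n)
      (t / eps ^+ 2 / (2 * (1 + t * S))) * (g k * eta k ^+ 2))).
    rewrite -mulr_sumr.
    rewrite (_ : t * u / _ = t / eps ^+ 2 / (2 * (1 + t * S)) * (eps ^+ 2 * u)).
      by rewrite ler_wpM2l// !divr_ge0 ?sqr_ge0 ?(ltW t0) ?(ltW tS0).
    by field; rewrite (gt_eqF eps0) gt_eqF// ltr_pwDl// mulr_ge0// ltW.
  rewrite !big_nat; apply: ler_sum => k /andP[_ kn].
  (* Each weight is at most S, so all denominators 1 + t g_k can be replaced by 1 + t S and the
     quadratic bound [gu] applies to the sum. *)
  have gkS : g k <= S.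
    apply: le_trans gS; rewrite (big_rem k)/= ?mem_index_iota//.
    by rewrite lerDl sumr_ge0.
  rewrite (_ : _ * (g k * _) = tg k * (eta k / eps) ^+ 2 / (2 * (1 + t * S))).
    apply: ler_wpM2l; first by rewrite mulr_ge0 ?sqr_ge0.
    rewrite lef_pV2 ?posrE//; last by rewrite mulr_gt0// ltr_pwDl.
    by rewrite ler_pM2l// lerD2l ler_wpM2l// ltW.
  rewrite /tg; field; rewrite (gt_eqF eps0) gt_eqF// ltr_pwDl// mulr_ge0//.
  exact: ltW.
apply: (@le_trans _ _ (Eobs xi eps (fun=> 0%R) (fun y => 1 - phi y)%R +
  ereal_sup [set Eobs xi eps eta (fun y => 1 - (1 - phi y))%R
            | eta in Theta2r a sigma r])%E).
  by apply: ereal_inf_lbound; exists (fun y => 1 - phi y).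
rewrite E0 (_ : 1 - A * (1 - B) = (1 - A) + A * B); last by ring.
rewrite (EFinD (1 - A)) leeD2l//; apply: ge_ereal_sup => _ [eta etain <-].
exact: power.
Qed.

End gamma_bounds.

(** * From error bounds to distinguishability conditions *)

Section distinguishability.
Context {R : realType} (F : set_system R) {FF : ProperFilter F}.
Variables (gam u : R -> R) (S : R).
Hypothesis S0 : 0 < S.
Hypothesis u0 : \forall x \near F, 0 <= u x.
Hypothesis gam_le : \forall x \near F, forall t, 0 < t ->
  gam x <= 1 - expR (- (t * S / 2)) *
    (1 - expR (- (t * u x / (2 * (1 + t * S))))).
Hypothesis gam_ge : \forall x \near F, 3 / 4 * expR (- u x) <= gam x.
Hypothesis gam_ge' : \forall x \near F, forall tau, 0 < tau ->
  1 - tau / 2 - (expR (u x) - 1) / (2 * tau) <= gam x.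

Lemma gamma_cvg0 : gam x @[x --> F] --> (0 : R) <-> u x @[x --> F] --> +oo.
Proof.
split => [gam0|uoo].
- apply/cvgryPge => M; near=> x.
  have h1 : gam x < 3 / 4 * expR (- M).
    by near: x; apply: (cvgr_lt 0) => //; rewrite mulr_gt0 ?expR_gt0.
  have h2 : 3 / 4 * expR (- u x) <= gam x by near: x.
  have := le_lt_trans h2 h1; rewrite ltr_pM2l// ltr_expR ltrN2.
  exact: ltW.
- apply/cvgrPdist_le => e e0.
  (* With t S = e the first factor exp (- t S / 2) is at least 1 - e/2, which uses up half of the
     tolerance. *)
  pose t := e / S; have t0 : 0 < t by rewrite divr_gt0.
  have tS : t * S = e by rewrite divfK// gt_eqF.
  pose k := t / (2 * (1 + t * S)).
  have k0 : 0 < k by rewrite divr_gt0// mulr_gt0// tS addr_gt0.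
  near=> x.
  (* The threshold gives exp (- k u) <= 1 / (1 + k u) <= e/2, the other half. *)
  have h1 : 2 / e / k <= u x by near: x; move/cvgryPge : uoo; exact.
  have h2 : gam x <= 1 - expR (- (t * S / 2)) *
    (1 - expR (- (t * u x / (2 * (1 + t * S))))).
    by apply: (near gam_le x).
  have h3 : 0 <= gam x.
    apply: (@le_trans _ _ (3 / 4 * expR (- u x))); last by near: x.
    by rewrite mulr_ge0// expR_ge0.
  rewrite sub0r normrN ger0_norm//; apply: (le_trans h2).
  rewrite (_ : t * u x / _ = k * u x); last by rewrite /k mulrAC.
  have h4 : expR (- (k * u x)) <= e / 2.
    rewrite expRN -[leRHS]invf_div lef_pV2 ?posrE ?expR_gt0 ?divr_gt0//.
    apply: (@le_trans _ _ (1 + k * u x)); last exact: expR_ge1Dx.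
    move: h1; rewrite ler_pdivrMr// (mulrC (u x)) => h1.
    by rewrite (le_trans h1)// lerDr.
  have h5 := expR_ge1Dx (- (t * S / 2)); rewrite tS in h5 *.
  have h6 : expR (- (e / 2)) <= 1.
    by rewrite -[leRHS]expR0 ler_expR oppr_le0 divr_ge0// ltW.
  have h7 : expR (- (e / 2)) * expR (- (k * u x)) <= expR (- (k * u x)).
    by rewrite ler_piMl// expR_ge0.
  lra.
Unshelve. all: by end_near. Qed.

(** If u stays above some e > 0, the upper bound at t = 1 keeps gam away from 1. Conversely, small u
    makes the lower bound with a small tau close to 1. *)
Lemma gamma_cvg1 :
  gam x @[x --> F] --> (1 : R) <-> u x @[x --> F] --> (0 : R).
Proof.
pose c := expR (- (S / 2)); pose k := (2 * (1 + S))^-1.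
have c0 : 0 < c by exact: expR_gt0.
have k0 : 0 < k by rewrite invr_gt0 mulr_gt0// addr_gt0.
have gk : \forall x \near F, gam x <= 1 - c * (1 - expR (- (k * u x))).
  apply: filterS gam_le => x /(_ 1 ltr01).
  by rewrite !mul1r [u x / _]mulrC.
split => [gam1|uz]; apply/cvgrPdist_le => e e0; near=> x.
- have ux : 0 <= u x by near: x.
  rewrite sub0r normrN ger0_norm// leNgt; apply/negP => eu.
  have h1 : 1 - c * (1 - expR (- (k * e))) < gam x.
    near: x; apply: (cvgr_gt 1) => //.
    rewrite gtrBl mulr_gt0// subr_gt0 -[ltRHS]expR0 ltr_expR oppr_lt0.
    by rewrite mulr_gt0.
  have h2 : gam x <= 1 - c * (1 - expR (- (k * u x))) by near: x.
  have := lt_le_trans h1 h2; rewrite ltrD2l ltrN2 ltr_pM2l// ltrD2l ltrN2.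
  by rewrite ltr_expR ltrN2 ltr_pM2l// ltNge (ltW eu).
- have ux : 0 <= u x by near: x.
  have h1 : gam x <= 1.
    apply: (@le_trans _ _ (1 - c * (1 - expR (- (k * u x))))); first by near: x.
    rewrite gerBl mulr_ge0 ?(ltW c0)// subr_ge0 -[leRHS]expR0 ler_expR.
    by rewrite oppr_le0 mulr_ge0// ltW.
  (* Taking tau = e, the bound exp u - 1 < e^2 makes both subtracted terms at most e/2. *)
  have h2 : 1 - e / 2 - (expR (u x) - 1) / (2 * e) <= gam x.
    by apply: (near gam_ge' x).
  have h3 : expR (u x) < 1 + e ^+ 2.
    have e2 : 0 < 1 + e ^+ 2 by rewrite addr_gt0// exprn_gt0.
    rewrite -[ltRHS]lnK ?posrE// ltr_expR; near: x.
    by apply: (cvgr_lt 0) => //; rewrite ln_gt0// ltrDl exprn_gt0.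
  rewrite ger0_norm ?subr_ge0// lerBlDl -lerBlDr; apply: le_trans h2.
  rewrite (_ : 1 - e = 1 - e / 2 - e ^+ 2 / (2 * e)); last first.
    by field; rewrite gt_eqF.
  by rewrite lerD2l lerN2 ler_wpM2r ?invr_ge0 ?mulr_ge0 ?(ltW e0)// lerBlDl ltW.
Unshelve. all: by end_near. Qed.

End distinguishability.

Theorem theorem4p6 (R : realType) (a sigma : nat -> R) (c : \bar R)
  (m : R -> nat) (r : R -> R)
  (a_gt0 : forall k, 0 < a k)
  (a_incr : nondecreasing_seq a)
  (sigma_gt0 : forall k, 0 < sigma k)
  (sigma_incr : nondecreasing_seq sigma)
  (sigma_ratio : sigma k.+1 / sigma k @[k --> \oo] --> +oo)
  (a_ratio : limn_einf (fun k => (a k.+1 / a k)%:E) = c)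
  (c_gt1 : (1%:E < c)%E)
  (m_spec : m_choice a m)
  (r_gt0 : forall eps : R, 0 < eps -> 0 < r eps)
  (r_to0 : r eps @[eps --> (0 : R)^'+] --> (0 : R)) :
  [/\ u_eps a sigma eps (r eps) / u_star a sigma m eps (r eps)
        @[eps --> (0 : R)^'+] --> (1 : R),
      (exists o1 o2 : R -> R,
        [/\ o1 eps @[eps --> (0 : R)^'+] --> (0 : R),
            o2 eps @[eps --> (0 : R)^'+] --> (0 : R) &
            \forall eps \near (0 : R)^'+,
              u_lin a sigma m eps (r eps) * (2^-1 + o1 eps)
                <= u_eps a sigma eps (r eps)
                <= u_lin a sigma m eps (r eps) * ((Num.sqrt 2)^-1 + o2 eps)]) &
      (forall (d : measure_display) (T : measurableType d)
          (P : probability T R) (xi : nat -> {RV P >-> R}),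
        iid_standard_normal xi ->
        (gamma_eps xi a sigma eps (r eps) @[eps --> (0 : R)^'+] --> 0%:E <->
           u_lin a sigma m eps (r eps) @[eps --> (0 : R)^'+] --> +oo) /\
        (gamma_eps xi a sigma eps (r eps) @[eps --> (0 : R)^'+] --> 1%:E <->
           u_lin a sigma m eps (r eps) @[eps --> (0 : R)^'+] --> (0 : R)))].
Proof.
split; [by apply: (u_eps_equiv_u_star (c := c))|by apply: (u_eps_rate (c := c))|].
move=> d T P xi xi_iid.
have [S S0 weights] := near_test_weights a_gt0 a_incr sigma_gt0 sigma_ratio
  a_ratio c_gt1 m_spec r_gt0 r_to0.
pose u eps := u_lin a sigma m eps (r eps).
pose ga eps := gamma_eps xi a sigma eps (r eps).
have eps_gt0 : \forall eps \near (0 : R)^'+, 0 < eps by exact: nbhs_right_gt.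
have uN : \forall eps \near (0 : R)^'+, 0 <= u eps.
  apply: filterS2 eps_gt0 weights => eps e0 [p [g [eta0 [_ _ _ h]]]].
  have e2 : 0 < eps ^+ 2 by rewrite exprn_gt0.
  by rewrite -(pmulr_rge0 _ e2) -h sumr_ge0// => k _; exact: sqr_ge0.
have ga_le : \forall eps \near (0 : R)^'+, forall t, 0 < t ->
    (ga eps <= (1 - expR (- (t * S / 2)) *
      (1 - expR (- (t * u eps / (2 * (1 + t * S))))))%:E)%E.
  apply: filterS3 eps_gt0 uN weights => eps e0 u0.
  move=> [p [g [eta0 [[g0 gS gu] _ _ _]]]] t t0.
  exact: (gamma_eps_le xi_iid e0 t0 g0 u0 gS gu).
have ga_ge : \forall eps \near (0 : R)^'+, forall q0 q1 q2, 0 <= q1 -> 0 <= q2 ->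
    (forall L, 0 <= L -> q0 + q1 * L - q2 * L ^+ 2 <= Num.min 1 L) ->
    ((q0 + q1 - q2 * expR (u eps))%:E <= ga eps)%E.
  apply: filterS2 eps_gt0 weights => eps e0 [p [g [eta0 [_ h1 h2 h3]]]].
  move=> q0 q1 q2 q10 q20 hq.
  have := gamma_eps_ge xi_iid e0 h1 h2 q10 q20 hq.
  by rewrite h3 mulrAC divff ?mul1r// gt_eqF// exprn_gt0.
have ga_ge1 : \forall eps \near (0 : R)^'+,
    ((3 / 4 * expR (- u eps))%:E <= ga eps)%E.
  apply: filterS2 uN ga_ge => eps u0 h.
  pose v := expR (- u eps).
  have v0 : 0 < v by exact: expR_gt0.
  have v1 : v <= 1 by rewrite -[leRHS]expR0 ler_expR oppr_le0.
  (* The minorant v L - (v L)^2 / 4 has maximum 1, and v <= 1 puts it below L. With v = exp (- u)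
     and E L^2 = exp u its mean is 3 v / 4. *)
  have := h 0 v (v ^+ 2 / 4) (ltW v0).
  have -> : 0 + v - v ^+ 2 / 4 * expR (u eps) = 3 / 4 * v.
    have : v * expR (u eps) = 1 by rewrite /v -expRD addNr expR0.
    by move=> vu; rewrite add0r expr2 -!mulrA (mulrCA v 4^-1) vu; field.
  apply; first by rewrite divr_ge0 ?sqr_ge0.
  move=> L L0; rewrite le_min; apply/andP; split.
    by rewrite -subr_ge0 (_ : _ - _ = (1 - v * L / 2) ^+ 2) ?sqr_ge0//; field.
  rewrite add0r; apply: (@le_trans _ _ (v * L)).
    by rewrite gerBl mulr_ge0 ?sqr_ge0// divr_ge0 ?sqr_ge0.
  by rewrite ler_piMl.
have ga_ge2 : \forall eps \near (0 : R)^'+, forall tau, 0 < tau ->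
    ((1 - tau / 2 - (expR (u eps) - 1) / (2 * tau))%:E <= ga eps)%E.
  apply: filterS ga_ge => eps h tau t0.
  have t0' : tau != 0 by rewrite gt_eqF.
  (* These coefficients expand 1 - tau/2 - (L - 1)^2 / (2 tau), which is at most 1 - |L - 1| <=
     min(1, L); the mean of (L - 1)^2 is exp u - 1. *)
  have := h (1 - tau / 2 - (2 * tau)^-1) tau^-1 (2 * tau)^-1.
  rewrite (_ : _ + tau^-1 - _ =
    1 - tau / 2 - (expR (u eps) - 1) / (2 * tau)); last by field.
  apply; rewrite ?invr_ge0 ?mulr_ge0 ?(ltW t0)//.
  move=> L L0; rewrite le_min; apply/andP; split; rewrite -subr_ge0.
    rewrite (_ : _ - _ = tau / 2 + (L - 1) ^+ 2 / (2 * tau)); last by field.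
    by rewrite addr_ge0 ?divr_ge0 ?sqr_ge0 ?mulr_ge0 ?(ltW t0).
  rewrite (_ : _ - _ = (tau + L - 1) ^+ 2 / (2 * tau)); last by field.
  by rewrite divr_ge0 ?sqr_ge0 ?mulr_ge0 ?(ltW t0).
(* The minimax error is an extended real; being finite for small [eps], it has the same real limits
   as its [fine] part. *)
have ga_fin : \forall eps \near (0 : R)^'+, ga eps \is a fin_num.
  apply: filterS2 ga_le ga_ge1 => eps /(_ 1 ltr01) h1 h2.
  by rewrite fin_numElt (lt_le_trans _ h2) ?ltNyr//= (le_lt_trans h1)// ltry.
have fineE l : ga eps @[eps --> (0 : R)^'+] --> l%:E <->
    fine (ga eps) @[eps --> (0 : R)^'+] --> l.
  split; first by move/fine_cvgP => [].
  by move=> h; apply/fine_cvgP; split.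
have le1 : \forall eps \near (0 : R)^'+, forall t, 0 < t ->
    fine (ga eps) <= 1 - expR (- (t * S / 2)) *
      (1 - expR (- (t * u eps / (2 * (1 + t * S))))).
  apply: filterS2 ga_fin ga_le => eps hf h t t0.
  by rewrite -lee_fin fineK// h.
have ge1 : \forall eps \near (0 : R)^'+, 3 / 4 * expR (- u eps) <= fine (ga eps).
  apply: filterS2 ga_fin ga_ge1 => eps hf h.
  by rewrite -lee_fin fineK.
have ge2 : \forall eps \near (0 : R)^'+, forall tau, 0 < tau ->
    1 - tau / 2 - (expR (u eps) - 1) / (2 * tau) <= fine (ga eps).
  apply: filterS2 ga_fin ga_ge2 => eps hf h t t0.
  by rewrite -lee_fin fineK// h.
split.
- exact: iff_trans (fineE 0) (gamma_cvg0 S0 le1 ge1).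
- exact: iff_trans (fineE 1) (gamma_cvg1 S0 uN le1 ge2).
Qed.
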